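(* Let $F$ be a finite field with $\mathrm{char}(F)=p\geq 5$. Let $E$ and $E'$ be elliptic curves in $\mathbb{P}^2_F$ given by (short) Weierstrass equations with coefficients in $F$, with identity elements $\mathcal{O}$ and $\mathcal{O}'$ respectively, and let $P\in E(F)\setminus\{\mathcal{O}\}$ and $P'\in E'(F)\setminus\{\mathcal{O}'\}$. Then the following are equivalent. (1) The groups $G_{E,P}(F)$ and $G_{E',P'}(F)$ are isomorphic (as abstract groups). (2) There exist $\sigma\in\mathrm{Gal}(F/\mathbb{F}_p)$ and an isomorphism $\varphi:E'\to\sigma(E)$ of elliptic curves such that $\varphi(P')=\sigma(P)$.
   Context: A Weierstrass equation means a short one: $y^2z=x^3+axz^2+bz^3$ with $a,b\in F$ and $4a^3+27b^2\neq 0$; the identity element is $\mathcal{O}=(0:1:0)$. An isomorphism of elliptic curves (defined over $F$) is an isomorphism of projective varieties mapping identity element to identity element. For $\sigma\in\mathrm{Gal}(F/\mathbb{F}_p)$, if $E$ is defined by $f=0$ then $\sigma(E)$ is defined by $\sigma(f)=0$, where $\sigma$ acts on the coefficients of $f$; and $\sigma(a_1:a_2:a_3)=(\sigma(a_1):\sigma(a_2):\sigma(a_3))\in\sigma(E)(F)$ for $(a_1:a_2:a_3)\in E(F)$. The group $G_{E,P}(F)$: for $P=(\lambda:\mu:1)\in E(F)\setminus\{\mathcal{O}\}$ put $$J_{E,P}=\begin{pmatrix} y_1-\lambda y_3 & y_2-\mu y_3 & 0\\ y_2+\mu y_3 & \lambda y_1+(a+\lambda^2)y_3 & y_1\\ 0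 & y_1 & -y_3\end{pmatrix},\qquad B_{E,P}=\begin{pmatrix}0 & J_{E,P}\\ -J_{E,P}^{\mathrm t} & 0\end{pmatrix}.$$ Write $B_{E,P}=B_1y_1+B_2y_2+B_3y_3$ with $B_i\in\mathrm{Mat}_6(F)$ and let $t:F^6\times F^6\to F^3$, $t(u,v)=(u^{\mathrm t}B_1v,u^{\mathrm t}B_2v,u^{\mathrm t}B_3v)$. Then $G_{E,P}(F)$ is the group with underlying set $F^6\oplus F^3$ and multiplication $(v,w)\cdot(v',w')=(v+v',\,w+w'+\tfrac12 t(v,v'))$. *)

(* Defs.v *)
From HB Require Import structures.
From mathcomp Require Import all_boot all_order all_algebra.
From mathcomp Require Import all_fingroup all_solvable all_field.
From mathcomp.multinomials Require Import mpoly.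

Set Implicit Arguments.
Unset Strict Implicit.
Unset Printing Implicit Defensive.

Import GRing.Theory.
Local Open Scope ring_scope.

(* A point of P^2(k) is a line through the origin of k^3. *)
Record P2 (k : fieldType) := Pt {
  line :> {vspace 'rV[k]_3};
  dim_line : \dim line == 1%N }.

HB.instance Definition _ (k : fieldType) := [isSub for @line k].
HB.instance Definition _ (k : fieldType) := [Choice of P2 k by <:].

Lemma dim_span1 (k : fieldType) (v : 'rV[k]_3) : v != 0 -> \dim <[v]> == 1%N.
Proof. by rewrite dim_vline => ->. Qed.

Definition mkpt (k : fieldType) (v : 'rV[k]_3) (nz : v != 0) : P2 k :=
  Pt (dim_span1 nz).

(* Homogeneous coordinates: an arbitrary generator of the line.  Everything
   computed from them below is invariant under scaling. *)
Definition hc (k : fieldType) (Q : P2 k) : 'rV[k]_3 := vpick Q.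

Lemma hc_neq0 (k : fieldType) (Q : P2 k) : hc Q != 0.
Proof. by rewrite vpick0 -dimv_eq0 (eqP (dim_line Q)). Qed.

Lemma map_hc_neq0 (k l : fieldType) (f : {rmorphism k -> l}) (Q : P2 k) :
  map_mx f (hc Q) != 0.
Proof. by rewrite map_mx_eq0 hc_neq0. Qed.

Definition map_pt (k l : fieldType) (f : {rmorphism k -> l}) (Q : P2 k) : P2 l :=
  mkpt (map_hc_neq0 f Q).

Definition row3 (R : Type) (x y z : R) : 'rV[R]_3 :=
  \row_(i < 3) nth x [:: x; y; z] i.

Lemma row010_neq0 (k : fieldType) : row3 0 1 0 != 0 :> 'rV[k]_3.
Proof.
apply/eqP => /rowP/(_ (inord 1)); rewrite !mxE inordK //= => /eqP.
by rewrite oner_eq0.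
Qed.

Definition Opt (k : fieldType) : P2 k := mkpt (row010_neq0 k).

(* The set of k-points of the plane curve f = 0; only used for homogeneous f. *)
Definition curve (k : fieldType) (f : {mpoly k[3]}) : {pred P2 k} :=
  [pred Q | f.@[hc Q 0] == 0].

(* F is the field of definition and iota : F -> K an algebraic closure.  A
   curve f = 0 over F is identified with its set of K-points; a morphism
   defined over F is a map on K-points which is locally, for the Zariski
   topology, given by three homogeneous polynomials of the same degree with
   coefficients in F.  The value of phi outside of the source is irrelevant. *)

Section Morphisms.
Variables (F K : fieldType) (iota : {rmorphism F -> K}).

Definition gcurve (f : {mpoly F[3]}) : {pred P2 K} := curve (map_mpoly iota f).

Definition heval (h : 'I_3 -> {mpoly F[3]}) (Q : P2 K) : 'rV[K]_3 :=
  \row_i (map_mpoly iota (h i)).@[hc Q 0].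

(* The local expression h is required to compute phi on the open set where h
   does not vanish identically; a smaller neighbourhood, given by g <> 0, is
   covered by replacing h with g * h. *)
Definition is_morphism (f g : {mpoly F[3]}) (phi : P2 K -> P2 K) : Prop :=
  (forall Q, Q \in gcurve f -> phi Q \in gcurve g) /\
  (forall Q, Q \in gcurve f ->
     exists (d : nat) (h : 'I_3 -> {mpoly F[3]}),
       [/\ forall i, h i \is d.-homog,
           heval h Q != 0
         & forall R, R \in gcurve f -> heval h R != 0 ->
             phi R = <[heval h R]>%VS :> {vspace 'rV[K]_3}]).

Definition is_isomorphism (f g : {mpoly F[3]}) (phi : P2 K -> P2 K) : Prop :=
  is_morphism f g phi /\
  exists psi : P2 K -> P2 K,
    [/\ is_morphism g f psi,
        {in gcurve f, cancel phi psi}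
      & {in gcurve g, cancel psi phi}].

Definition is_ell_isomorphism (f g : {mpoly F[3]}) (phi : P2 K -> P2 K) : Prop :=
  is_isomorphism f g phi /\ phi (Opt K) = Opt K.

End Morphisms.

Record weierstrass (F : fieldType) := Weierstrass {
  wa : F;
  wb : F;
  w_disc : 4%:R * wa ^+ 3 + 27%:R * wb ^+ 2 != 0 }.

(* y^2 z - (x^3 + a x z^2 + b z^3), with (x, y, z) = ('X_0, 'X_1, 'X_2). *)
Definition weq (F : fieldType) (E : weierstrass F) : {mpoly F[3]} :=
  let x := 'X_0 in let y := 'X_1 in let z := 'X_(2%:R) in
  y ^+ 2 * z - (x ^+ 3 + wa E *: (x * z ^+ 2) + wb E *: z ^+ 3).

(* pPrimeCharType is F seen as an extension of 'F_p. *)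
Definition GalFp (F : finFieldType) (p : nat) (charFp : p \in [pchar F]) :
    {set gal_of {: pPrimeCharType charFp}} :=
  'Gal({: pPrimeCharType charFp} / 1)%g.

Definition gal_map (F : finFieldType) (p : nat) (charFp : p \in [pchar F])
    (sigma : gal_of {: pPrimeCharType charFp}) : {rmorphism F -> F} :=
  (sigma : {rmorphism pPrimeCharType charFp -> pPrimeCharType charFp}).

(* B is a phantom argument: it selects the group law. *)
Definition baer (F : finFieldType) n m (B : 'I_m -> 'M[F]_n) : predArgType :=
  ('cV[F]_n * 'cV[F]_m)%type.

Section BaerGroup.
Variables (F : finFieldType) (n m : nat) (B : 'I_m -> 'M[F]_n).

Definition tensor (u v : 'cV[F]_n) : 'cV[F]_m :=
  \col_(i < m) (u^T *m B i *m v) 0 0.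

Local Notation G := (baer B).

HB.instance Definition _ := Finite.on G.

Definition baer_mul (x y : G) : G :=
  (x.1 + y.1, x.2 + y.2 + 2%:R^-1 *: tensor x.1 y.1).

Definition baer_one : G := (0, 0).

(* The correction term vanishes when the B i are alternating. *)
Definition baer_inv (x : G) : G :=
  (- x.1, - x.2 + 2%:R^-1 *: tensor x.1 x.1).

Lemma tensorE u v i j : tensor u v i j = (u^T *m B i *m v) 0 0.
Proof. by rewrite mxE. Qed.

Lemma tensorDl u u' v : tensor (u + u') v = tensor u v + tensor u' v.
Proof.
by apply/colP => i; rewrite [RHS]mxE !tensorE linearD /= !mulmxDl mxE.
Qed.

Lemma tensorDr u v v' : tensor u (v + v') = tensor u v + tensor u v'.
Proof. by apply/colP => i; rewrite [RHS]mxE !tensorE mulmxDr mxE. Qed.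

Lemma tensorNl u v : tensor (- u) v = - tensor u v.
Proof.
by apply/colP => i; rewrite [RHS]mxE !tensorE linearN /= !mulNmx mxE.
Qed.

Lemma tensor0l v : tensor 0 v = 0.
Proof. by apply/colP => i; rewrite tensorE linear0 !mul0mx !mxE. Qed.

Fact baer_mulA : associative baer_mul.
Proof.
move=> [u u'] [v v'] [w w']; congr pair => /=; first by rewrite addrA.
rewrite tensorDl tensorDr !scalerDr -!addrA; do 2!congr (_ + _).
by rewrite [RHS]addrCA; congr (_ + _); rewrite addrC -addrA.
Qed.

Fact baer_mul1 : left_id baer_one baer_mul.
Proof.
by case=> u u'; congr pair => /=; rewrite ?tensor0l ?scaler0 ?addr0 add0r.
Qed.

Fact baer_mulV : left_inverse baer_one baer_inv baer_mul.
Proof.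
case=> u u'; congr pair => /=; first by rewrite addNr.
by rewrite tensorNl scalerN addrAC addrK addNr.
Qed.

HB.instance Definition _ :=
  Finite_isGroup.Build G baer_mulA baer_mul1 baer_mulV.

End BaerGroup.

Section GEP.
Variables (F : finFieldType) (E : weierstrass F) (P : P2 F).

(* A point of E other than (0 : 1 : 0) has nonzero third coordinate, so that
   P = (lambda : mu : 1). *)
Definition lambda : F := hc P 0 0 / hc P 0 2%:R.
Definition mu : F := hc P 0 1 / hc P 0 2%:R.

Definition J_EP : 'M[{mpoly F[3]}]_3 :=
  let y1 := 'X_0 in let y2 := 'X_1 in let y3 := 'X_(2%:R) in
  \matrix_(i < 3, j < 3)
    (nth [::]
      [:: [:: y1 - lambda *: y3; y2 - mu *: y3; 0];
          [:: y2 + mu *: y3; lambda *: y1 + (wa E + lambda ^+ 2) *: y3; y1];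
          [:: 0; y1; - y3]] i)`_j.

Definition B_EP : 'M[{mpoly F[3]}]_6 := block_mx 0 J_EP (- J_EP^T) 0.

(* B_EP = \sum_i B_coef i * 'X_i *)
Definition B_coef (i : 'I_3) : 'M[F]_6 := map_mx (mcoeff U_(i)) B_EP.

Definition G_EP : finGroupType := baer B_coef.

End GEP.

(* Main.v *)
(* Write P = (l, m).  As det J_{E,P} is the equation of E, the commutator tensor
   t of G_{E,P} determines E and P.

   An isomorphism of groups induces additive bijections of F^6 and F^3 carrying
   t to t'.  The centroid of t consists of the scalars only, so that these
   bijections are semilinear for the same automorphism sigma of F.  Hence there
   are X in GL_6(F) and Z in GL_3(F) with X^T B'(y) X = B^sigma(Z y), and it
   suffices to exhibit invariants.  Taking Pfaffians shows that the two cubics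
   differ by Z and a scalar; the Hessian covariant then recovers a and b, up to
   a^sigma = u^4 a', b^sigma = u^6 b'.  An invariant of degree 6 of the pencil B
   (an alternating contraction of tr (Q B Q B), where Q is the Pfaffian adjoint
   of B) equals l up to a constant, and gives l^sigma = u^2 l'; the equation of
   the curve gives m up to sign, and the sign can be absorbed by u.

   Conversely, let phi be an isomorphism of pointed curves.  The functions x and
   y pulled back by phi are regular away from O, hence polynomials in x and y.
   Comparing orders of poles at O shows that these orders are 2 and 3, so that
   phi (x, y) = (u^2 x, u^3 y); rescaling the rows and columns of J yields an
   isomorphism of groups. *)

Require Import Defs.
From HB Require Import structures.
From mathcomp Require Import all_boot all_order all_algebra.
From mathcomp Require Import all_fingroup all_solvable all_field.
From mathcomp.multinomials Require Import mpoly.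
From mathcomp Require Import ring zify.

Set Implicit Arguments.
Unset Strict Implicit.
Unset Printing Implicit Defensive.

Import GRing.Theory.
Local Open Scope ring_scope.

(** * Matrices of size 3 *)

(** An invariant known only up to a nonzero scalar would be useless: the scalings of a, b and l have
    to come from one and the same u. This u is [\det Z / e], where e is the factor by which the
    Pfaffian cubics differ. A cubic f' = c f(Z y) has a' = (c det Z)^4 a and b' = (c det Z)^6 b,
    here with c = 1/e. The Pfaffian adjoint satisfies X Q(Z y) X^T = e Q'(y), so X drops out of tr
    (Q B Q B) and leaves e^2, while each volume form of F^3 contributes one det Z. As l must scale
    by u^2, two volume forms are required, hence six slots to contract: two in each polarised Q and
    one in each B. This is where the degree 6 comes from. A second obstacle is that F is finite, so
    that values at F-points need not determine polynomials. The pencils, however, are linear in y: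
    their identity is checked on a basis and then holds over any commutative extension of F, in
    particular at the generic point. *)

Lemma ord3P (i : 'I_3) : [\/ i = 0, i = 1 | i = 2%:R].
Proof.
case: i => [[|[|[|i]]] lti] //.
- by apply: Or31; apply: val_inj.
- by apply: Or32; apply: val_inj.
- by apply: Or33; apply: val_inj.
Qed.

Lemma sum3E (V : nmodType) (G : 'I_3 -> V) : \sum_i G i = G 0 + G 1 + G 2%:R.
Proof.
rewrite !big_ord_recr big_ord0 /= add0r.
by congr (G _ + G _ + G _); apply: val_inj.
Qed.

Definition mx3 (T : nmodType) (s : seq (seq T)) : 'M[T]_3 :=
  \matrix_(i < 3, j < 3) (nth [::] s i)`_j.

Lemma mx3P (T : Type) (A B : 'M[T]_3) :
  A 0 0 = B 0 0 -> A 0 1 = B 0 1 -> A 0 2%:R = B 0 2%:R ->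
  A 1 0 = B 1 0 -> A 1 1 = B 1 1 -> A 1 2%:R = B 1 2%:R ->
  A 2%:R 0 = B 2%:R 0 -> A 2%:R 1 = B 2%:R 1 -> A 2%:R 2%:R = B 2%:R 2%:R ->
  A = B.
Proof.
move=> *; apply/matrixP => i j.
by case: (ord3P i) => ->; case: (ord3P j) => ->.
Qed.

Lemma mulmx3 (R : nzRingType) m n (A : 'M[R]_(m, 3)) (B : 'M[R]_(3, n)) i j :
  (A *m B) i j = A i 0 * B 0 j + A i 1 * B 1 j + A i 2%:R * B 2%:R j.
Proof. by rewrite mxE sum3E. Qed.

Lemma mxtrace3 (R : nzRingType) (A : 'M[R]_3) :
  \tr A = A 0 0 + A 1 1 + A 2%:R 2%:R.
Proof. exact: sum3E. Qed.

Lemma det2 (R : comNzRingType) (A : 'M[R]_2) :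
  \det A = A 0 0 * A 1 1 - A 0 1 * A 1 0.
Proof.
rewrite (expand_det_row _ 0) !big_ord_recr big_ord0 /= add0r /cofactor.
rewrite !det_mx11 !mxE /= expr0 expr1.
rewrite (_ : widen_ord _ _ = 0); last exact: val_inj.
rewrite (_ : ord_max = 1); last exact: val_inj.
rewrite (_ : lift 0 0 = 1); last exact: val_inj.
rewrite (_ : lift 1 0 = 0); last exact: val_inj.
ring.
Qed.

Lemma lift3 :
  (lift (0 : 'I_3) (0 : 'I_2) = 1) * (lift (0 : 'I_3) (1 : 'I_2) = 2%:R) *
  (lift (1 : 'I_3) (0 : 'I_2) = 0) * (lift (1 : 'I_3) (1 : 'I_2) = 2%:R) *
  (lift (2%:R : 'I_3) (0 : 'I_2) = 0) * (lift (2%:R : 'I_3) (1 : 'I_2) = 1).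
Proof. by do !split; apply: val_inj. Qed.

Lemma det3 (R : comNzRingType) (A : 'M[R]_3) :
  \det A = A 0 0 * (A 1 1 * A 2%:R 2%:R - A 1 2%:R * A 2%:R 1)
         - A 0 1 * (A 1 0 * A 2%:R 2%:R - A 1 2%:R * A 2%:R 0)
         + A 0 2%:R * (A 1 0 * A 2%:R 1 - A 1 1 * A 2%:R 0).
Proof.
rewrite (expand_det_row _ 0) sum3E /cofactor !det2 !mxE !lift3 /=.
ring.
Qed.

Lemma adj3 (R : comNzRingType) (A : 'M[R]_3) :
  \adj A = mx3
   [:: [:: A 1 1 * A 2%:R 2%:R - A 1 2%:R * A 2%:R 1;
           A 0 2%:R * A 2%:R 1 - A 0 1 * A 2%:R 2%:R;
           A 0 1 * A 1 2%:R - A 0 2%:R * A 1 1];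
       [:: A 1 2%:R * A 2%:R 0 - A 1 0 * A 2%:R 2%:R;
           A 0 0 * A 2%:R 2%:R - A 0 2%:R * A 2%:R 0;
           A 0 2%:R * A 1 0 - A 0 0 * A 1 2%:R];
       [:: A 1 0 * A 2%:R 1 - A 1 1 * A 2%:R 0;
           A 0 1 * A 2%:R 0 - A 0 0 * A 2%:R 1;
           A 0 0 * A 1 1 - A 0 1 * A 1 0]].
Proof.
apply/matrixP => i j; rewrite !mxE /cofactor det2 !mxE.
by case: (ord3P i) => ->; case: (ord3P j) => ->; rewrite !lift3 /=; ring.
Qed.

(** * The invariant of degree 6 *)

Definition alt3 (T : Type) (R : zmodType) (G : T -> T -> T -> R) x y z : R :=
  G x y z + G y z x + G z x y - G y x z - G x z y - G z y x.

(* Used for the contraction of two indices with two volume forms of F^3. *)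
Definition alt33 (T : Type) (R : zmodType) (G : T -> T -> T -> T -> T -> T -> R)
    x1 x2 x3 y1 y2 y3 : R :=
  alt3 (fun x1 x2 x3 => alt3 (fun y1 y2 y3 => G x1 y1 x2 y2 x3 y3) y1 y2 y3)
    x1 x2 x3.

Section Jmatrix.
Variable R : comNzRingType.
Implicit Types (a l m : R) (x y z : 'cV[R]_3).

Definition e3 (i : 'I_3) : 'cV[R]_3 := delta_mx i 0.

(** The ring is arbitrary because the matrix is needed both over F and over F[y1, y2, y3], at the
    generic point. *)
Definition Jm a l m y : 'M[R]_3 :=
  mx3 [:: [:: y 0 0 - l * y 2%:R 0; y 1 0 - m * y 2%:R 0; 0];
          [:: y 1 0 + m * y 2%:R 0;
              l * y 0 0 + (a + l ^+ 2) * y 2%:R 0; y 0 0];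
          [:: 0; y 0 0; - y 2%:R 0]].

(* The polarisation of [y |-> \adj (Jm a l m y)]. *)
Definition Km a l m x y : 'M[R]_3 :=
  let x0 := x 0 0 in let x1 := x 1 0 in let x2 := x 2%:R 0 in
  let y0 := y 0 0 in let y1 := y 1 0 in let y2 := y 2%:R 0 in
  let xD := l * x0 + (a + l ^+ 2) * x2 in
  let yD := l * y0 + (a + l ^+ 2) * y2 in
  let p01 := (x1 - m * x2) in let q01 := (y1 - m * y2) in
  let p10 := (x1 + m * x2) in let q10 := (y1 + m * y2) in
  let p00 := (x0 - l * x2) in let q00 := (y0 - l * y2) in
  mx3 [:: [:: - (xD * y2 + yD * x2 + (x0 * y0) *+ 2);
              p01 * y2 + q01 * x2; p01 * y0 + q01 * x0];
          [:: p10 * y2 + q10 * x2; - (p00 * y2 + q00 * x2);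
              - (p00 * y0 + q00 * x0)];
          [:: p10 * y0 + q10 * x0; - (p00 * y0 + q00 * x0);
              p00 * yD + q00 * xD - p01 * q10 - q01 * p10]].

Lemma mx3E (s : seq (seq R)) i j : mx3 s i j = (nth [::] s i)`_j.
Proof. by rewrite mxE. Qed.

Lemma adj_mx3 (a b c d e f g h k : R) :
  \adj (mx3 [:: [:: a; b; c]; [:: d; e; f]; [:: g; h; k]]) =
  mx3 [:: [:: e * k - f * h; c * h - b * k; b * f - c * e];
          [:: f * g - d * k; a * k - c * g; c * d - a * f];
          [:: d * h - e * g; b * g - a * h; a * e - b * d]].
Proof. by rewrite adj3 !mx3E. Qed.

Lemma Km_polar a l m x y : Km a l m x y =
  \adj (Jm a l m (x + y)) - \adj (Jm a l m x) - \adj (Jm a l m y).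
Proof.
rewrite /Jm !adj_mx3 ![(x + y) _ _]mxE /Km.
apply/mx3P; rewrite ![in RHS]mxE ![in LHS]mxE /=; ring.
Qed.

Lemma Jm_lin a l m c x y :
  Jm a l m (c *: x + y) = c *: Jm a l m x + Jm a l m y.
Proof. by apply/mx3P; rewrite !mxE /=; ring. Qed.

Lemma Km_linl a l m c x x' y :
  Km a l m (c *: x + x') y = c *: Km a l m x y + Km a l m x' y.
Proof. by apply/mx3P; rewrite !mxE /=; ring. Qed.

Lemma KmC a l m x y : Km a l m x y = Km a l m y x.
Proof. by apply/mx3P; rewrite !mxE /=; ring. Qed.

Definition tr_KJKJ a l m x1 y1 x2 y2 x3 y3 : R :=
  \tr (Km a l m x1 y1 *m Jm a l m x2 *m (Km a l m x3 y3 *m Jm a l m y2)).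

Lemma mul_mx3 (a b c d e f g h k a' b' c' d' e' f' g' h' k' : R) :
  mx3 [:: [:: a; b; c]; [:: d; e; f]; [:: g; h; k]] *m
  mx3 [:: [:: a'; b'; c']; [:: d'; e'; f']; [:: g'; h'; k']] =
  mx3 [:: [:: a * a' + b * d' + c * g'; a * b' + b * e' + c * h';
              a * c' + b * f' + c * k'];
          [:: d * a' + e * d' + f * g'; d * b' + e * e' + f * h';
              d * c' + e * f' + f * k'];
          [:: g * a' + h * d' + k * g'; g * b' + h * e' + k * h';
              g * c' + h * f' + k * k']].
Proof. by apply/mx3P; rewrite mulmx3 !mx3E. Qed.

Lemma tr_mx3 (a b c d e f g h k : R) :
  \tr (mx3 [:: [:: a; b; c]; [:: d; e; f]; [:: g; h; k]]) = a + e + k.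
Proof. by rewrite mxtrace3 !mx3E. Qed.

Lemma alt33_tr_KJKJ a l m :
  alt33 (tr_KJKJ a l m) (e3 0) (e3 1) (e3 2%:R) (e3 0) (e3 1) (e3 2%:R) =
  - 72%:R * l.
Proof.
(* Tabulating J and K on basis vectors, where most entries are constants, keeps the 36 traces small
   enough for [ring]. *)
have J0 : Jm a l m (e3 0) =
   mx3 [:: [:: 1; 0; 0];
     [:: 0; l; 1];
     [:: 0; 1; 0]].
  by apply/mx3P; rewrite !mxE /=; ring.
have J1 : Jm a l m (e3 1) =
   mx3 [:: [:: 0; 1; 0];
     [:: 1; 0; 0];
     [:: 0; 0; 0]].
  by apply/mx3P; rewrite !mxE /=; ring.
have J2 : Jm a l m (e3 2%:R) =
   mx3 [:: [:: - l; - m; 0];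
     [:: m; l ^+ 2 + a; 0];
     [:: 0; 0; - 1]].
  by apply/mx3P; rewrite !mxE /=; ring.
have K00 : Km a l m (e3 0) (e3 0) =
   mx3 [:: [:: - 2%:R; 0; 0];
     [:: 0; 0; - 2%:R];
     [:: 0; - 2%:R; 2%:R * l]].
  by apply/mx3P; rewrite !mxE /=; ring.
have K01 : Km a l m (e3 0) (e3 1) =
   mx3 [:: [:: 0; 0; 1];
     [:: 0; 0; 0];
     [:: 1; 0; 0]].
  by apply/mx3P; rewrite !mxE /=; ring.
have K02 : Km a l m (e3 0) (e3 2%:R) =
   mx3 [:: [:: - l; 0; - m];
     [:: 0; - 1; l];
     [:: m; l; a]].
  by apply/mx3P; rewrite !mxE /=; ring.
have K11 : Km a l m (e3 1) (e3 1) =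
   mx3 [:: [:: 0; 0; 0];
     [:: 0; 0; 0];
     [:: 0; 0; - 2%:R]].
  by apply/mx3P; rewrite !mxE /=; ring.
have K12 : Km a l m (e3 1) (e3 2%:R) =
   mx3 [:: [:: 0; 1; 0];
     [:: 1; 0; 0];
     [:: 0; 0; 0]].
  by apply/mx3P; rewrite !mxE /=; ring.
have K22 : Km a l m (e3 2%:R) (e3 2%:R) =
   mx3 [:: [:: - 2%:R * l ^+ 2 - 2%:R * a; - 2%:R * m; 0];
     [:: 2%:R * m; 2%:R * l; 0];
     [:: 0; 0; 2%:R * m ^+ 2 - 2%:R * l ^+ 3 - 2%:R * a * l]].
  by apply/mx3P; rewrite !mxE /=; ring.
have K10 := etrans (KmC _ _ _ _ _) K01.
have K20 := etrans (KmC _ _ _ _ _) K02.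
have K21 := etrans (KmC _ _ _ _ _) K12.
rewrite /alt33 /alt3 /tr_KJKJ !(J0, J1, J2, K00, K01, K02, K10, K11, K12, K20,
  K21, K22).
by rewrite !mul_mx3 !tr_mx3; ring.
Qed.

End Jmatrix.

Section Covariance.
Variable R : comNzRingType.
Implicit Types (a l m : R) (x y z : 'cV[R]_3).

Definition trilinear (G : 'cV[R]_3 -> 'cV[R]_3 -> 'cV[R]_3 -> R) :=
  [/\ forall c x x' y z, G (c *: x + x') y z = c * G x y z + G x' y z,
      forall c x y y' z, G x (c *: y + y') z = c * G x y z + G x y' z
    & forall c x y z z', G x y (c *: z + z') = c * G x y z + G x y z'].

Lemma cV3_sum x : x = x 0 0 *: e3 R 0 + (x 1 0 *: e3 R 1
  + x 2%:R 0 *: e3 R 2%:R).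
Proof.
by apply/colP => i; case: (ord3P i) => ->; rewrite !mxE /=; ring.
Qed.

Lemma lin3 (f : 'cV[R]_3 -> R) :
  (forall c x x', f (c *: x + x') = c * f x + f x') ->
  forall x, f x = x 0 0 * f (e3 R 0) + x 1 0 * f (e3 R 1)
    + x 2%:R 0 * f (e3 R 2%:R).
Proof.
move=> lf x; have f0 : f 0 = 0.
  by have:= lf (-1) 0 0; rewrite scaler0 addr0 mulN1r addNr.
rewrite {1}[x]cV3_sum -[x 2%:R 0 *: _]addr0 !lf f0; ring.
Qed.

Lemma alt3_trilinear G (Z : 'M[R]_3) : trilinear G ->
  alt3 G (col 0 Z) (col 1 Z) (col 2%:R Z) =
  \det Z * alt3 G (e3 R 0) (e3 R 1) (e3 R 2%:R).
Proof.
case=> G1 G2 G3; pose t i j k := G (e3 R i) (e3 R j) (e3 R k).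
pose d (f : 'I_3 -> R) x := x 0 0 * f 0 + x 1 0 * f 1 + x 2%:R 0 * f 2%:R.
have E x y z : G x y z = d (fun i => d (fun j => d (fun k => t i j k) z) y) x.
  rewrite (lin3 (fun c x x' => G1 c x x' y z)) /d /t.
  rewrite !(lin3 (fun c y y' => G2 c _ y y' z) y).
  by rewrite !(lin3 (fun c z z' => G3 c _ _ z z') z).
rewrite /alt3 !E /d det3 !mxE /=.
by ring.
Qed.

End Covariance.

(** * Skew-symmetric block matrices of size 6 *)

Section SixBySix.
Variable R : comNzRingType.
Implicit Types (a l m : R) (x y z : 'cV[R]_3).

Definition skew_block (A : 'M[R]_3) : 'M[R]_(3 + 3) := block_mx 0 A (- A^T) 0.

Definition Bm a l m y := skew_block (Jm a l m y).
(* The Pfaffian adjoint of [Bm]: see [mul_Qm_Bm]. *)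
Definition Qm a l m y := skew_block (- (\adj (Jm a l m y))^T).

Lemma mul_skew_block (A C : 'M[R]_3) :
  skew_block A *m skew_block C = block_mx (- (A *m C^T)) 0 0 (- (A^T *m C)).
Proof.
by rewrite /skew_block mulmx_block !(mul0mx, mulmx0, mulmxN, mulNmx) !(addr0,
  add0r).
Qed.

Lemma det_skew_block (A : 'M[R]_3) : \det (skew_block A) = \det A ^+ 2.
Proof.
pose U : 'M[R]_(3 + 3) := block_mx 1%:M 1%:M 0 1%:M.
pose L : 'M[R]_(3 + 3) := block_mx 1%:M 0 (- 1%:M) 1%:M.
(* [U *m L *m U] is the block matrix with rows (0, 1) and (-1, 0); its factors are unitriangular, so
   its determinant is 1. *)
have ->: skew_block A = U *m L *m U *m block_mx A^T 0 0 A.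
  rewrite !mulmx_block !(mul0mx, mulmx0, mulmxN, mulNmx, mul1mx, mulmx1).
  by rewrite !(addr0, add0r, subrr, addNr, mul0mx, mulNmx, mul1mx).
rewrite !det_mulmx !det_ublock !det_lblock !det1 det_tr.
by rewrite !mul1r expr2.
Qed.

Lemma mul_Qm_Bm a l m y :
  Qm a l m y *m Bm a l m y = (\det (Jm a l m y))%:M.
Proof.
rewrite /Qm /Bm mul_skew_block mulNmx opprK -trmx_mul mul_mx_adj.
rewrite raddfN /= trmxK mulNmx opprK mul_adj_mx tr_scalar_mx.
by rewrite -scalar_mx_block.
Qed.

(** The coefficient of the last cube is the b for which (l, m) lies on the curve, so the triple (a,
    l, m) encodes both the curve and the point. *)
Lemma det_Jm a l m y : \det (Jm a l m y) =
  y 1 0 ^+ 2 * y 2%:R 0 - (y 0 0 ^+ 3 + a * (y 0 0 * y 2%:R 0 ^+ 2)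
    + (m ^+ 2 - l ^+ 3 - a * l) * y 2%:R 0 ^+ 3).
Proof. by rewrite det3 !mx3E /=; ring. Qed.

Lemma skew_block_lin c (A B : 'M[R]_3) :
  skew_block (c *: A + B) = c *: skew_block A + skew_block B.
Proof.
rewrite /skew_block scale_block_mx add_block_mx !(scaler0, addr0).
by congr block_mx; apply/matrixP => i j; rewrite !mxE; ring.
Qed.

Lemma skew_blockB (A B : 'M[R]_3) :
  skew_block A - skew_block B = skew_block (A - B).
Proof. by rewrite addrC -scaleN1r -skew_block_lin scaleN1r addrC. Qed.

Lemma Bm_lin a l m c x y : Bm a l m (c *: x + y) = c *: Bm a l m x + Bm a l m y.
Proof. by rewrite /Bm Jm_lin skew_block_lin. Qed.

Definition Qp a l m x y := skew_block (- (Km a l m x y)^T).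

Lemma Qp_polar a l m x y :
  Qp a l m x y = Qm a l m (x + y) - Qm a l m x - Qm a l m y.
Proof.
rewrite /Qp Km_polar /Qm !skew_blockB; congr skew_block.
move: (\adj _) (\adj _) (\adj _) => A B C.
by apply/matrixP => i j; rewrite !mxE; ring.
Qed.

Lemma Qp_linl a l m c x x' y :
  Qp a l m (c *: x + x') y = c *: Qp a l m x y + Qp a l m x' y.
Proof.
rewrite /Qp Km_linl -skew_block_lin; congr skew_block.
move: (Km _ _ _ _ _) (Km _ _ _ _ _) => A B.
by apply/matrixP => i j; rewrite !mxE; ring.
Qed.

Lemma QpC a l m x y : Qp a l m x y = Qp a l m y x.
Proof. by rewrite /Qp KmC. Qed.

Definition tr4 (A B C D : 'M[R]_(3 + 3)) : R := \tr (A *m B *m (C *m D)).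

Lemma tr4_lin1 c A A' B C D :
  tr4 (c *: A + A') B C D = c * tr4 A B C D + tr4 A' B C D.
Proof. by rewrite /tr4 !mulmxDl -!scalemxAl linearD linearZ. Qed.

Lemma tr4_lin2 c A B B' C D :
  tr4 A (c *: B + B') C D = c * tr4 A B C D + tr4 A B' C D.
Proof.
by rewrite /tr4 mulmxDr !mulmxDl -scalemxAr -!scalemxAl linearD linearZ.
Qed.

Lemma tr4_lin3 c A B C C' D :
  tr4 A B (c *: C + C') D = c * tr4 A B C D + tr4 A B C' D.
Proof.
by rewrite /tr4 mulmxDl mulmxDr -scalemxAl -scalemxAr linearD linearZ.
Qed.

Lemma tr4_lin4 c A B C D D' :
  tr4 A B C (c *: D + D') = c * tr4 A B C D + tr4 A B C D'.
Proof. by rewrite /tr4 !mulmxDr -!scalemxAr linearD linearZ. Qed.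

(** Products of two skew blocks are block diagonal. One diagonal block gives the first trace;
    transposing the other gives the same expression with A and C exchanged. *)
Lemma tr4_skew (A B C D : 'M[R]_3) :
  tr4 (skew_block (- A^T)) (skew_block B) (skew_block (- C^T)) (skew_block D) =
  \tr (A *m B *m (C *m D)) + \tr (C *m B *m (A *m D)).
Proof.
rewrite /tr4 !mul_skew_block mulmx_block !(mul0mx, mulmx0).
rewrite !(addr0, add0r) mxtrace_block addrC !raddfN /= !trmxK.
rewrite !(mulNmx, mulmxN, opprK) !raddfN /= !opprK; congr (_ + _).
by rewrite -!trmx_mul mxtrace_tr -!mulmxA mxtrace_mulC -!mulmxA.
Qed.

Definition tr_QBQB a l m x1 y1 x2 y2 x3 y3 : R :=
  tr4 (Qp a l m x1 y1) (Bm a l m x2) (Qp a l m x3 y3) (Bm a l m y2).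

Lemma tr_QBQBE a l m x1 y1 x2 y2 x3 y3 : tr_QBQB a l m x1 y1 x2 y2 x3 y3 =
  tr_KJKJ a l m x1 y1 x2 y2 x3 y3 + tr_KJKJ a l m x3 y3 x2 y2 x1 y1.
Proof. exact: tr4_skew. Qed.

(** Exchanging the indices 1 and 3 changes the sign of both alternations, so the two summands
    contribute equally. *)
Lemma alt33_swap (G H : _ -> _ -> _ -> _ -> _ -> _ -> R) :
  (forall x1 y1 x2 y2 x3 y3,
     G x1 y1 x2 y2 x3 y3 = H x1 y1 x2 y2 x3 y3 + H x3 y3 x2 y2 x1 y1) ->
  forall x1 x2 x3 y1 y2 y3,
  alt33 G x1 x2 x3 y1 y2 y3 = alt33 H x1 x2 x3 y1 y2 y3 *+ 2.
Proof. by move=> GH x1 x2 x3 y1 y2 y3; rewrite /alt33 /alt3 !GH; ring. Qed.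

Lemma tr_QBQB_trilinear_l a l m y1 y2 y3 :
  trilinear (fun x1 x2 x3 => tr_QBQB a l m x1 y1 x2 y2 x3 y3).
Proof.
rewrite /tr_QBQB; split=> *.
- by rewrite Qp_linl tr4_lin1.
- by rewrite Bm_lin tr4_lin2.
- by rewrite Qp_linl tr4_lin3.
Qed.

Lemma tr_QBQB_trilinear_r a l m x1 x2 x3 :
  trilinear (fun y1 y2 y3 => tr_QBQB a l m x1 y1 x2 y2 x3 y3).
Proof.
rewrite /tr_QBQB; split=> *.
- by rewrite !(QpC a l m x1) Qp_linl tr4_lin1.
- by rewrite Bm_lin tr4_lin4.
- by rewrite !(QpC a l m x3) Qp_linl tr4_lin3.
Qed.

Lemma alt33C (G : _ -> _ -> _ -> _ -> _ -> _ -> R) x1 x2 x3 y1 y2 y3 :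
  alt33 G x1 x2 x3 y1 y2 y3 =
  alt3 (fun y1 y2 y3 => alt3 (fun x1 x2 x3 => G x1 y1 x2 y2 x3 y3) x1 x2 x3)
    y1 y2 y3.
Proof. by rewrite /alt33 /alt3; ring. Qed.

Lemma alt3_trily G : (forall x1 x2 x3,
  trilinear (fun y1 y2 y3 => G x1 y1 x2 y2 x3 y3)) ->
  forall x1 x2 x3, trilinear (fun y1 y2 y3 : 'cV[R]_3 =>
    alt3 (fun x1 x2 x3 : 'cV[R]_3 => G x1 y1 x2 y2 x3 y3 : R) x1 x2 x3).
Proof.
move=> tG x1 x2 x3; rewrite /alt3.
have t1 := tG x1 x2 x3; have t2 := tG x2 x3 x1; have t3 := tG x3 x1 x2.
have t4 := tG x2 x1 x3; have t5 := tG x1 x3 x2; have t6 := tG x3 x2 x1.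
case: t1 t2 t3 t4 t5 t6 => [a1 a2 a3] [b1 b2 b3] [c1 c2 c3] [d1 d2 d3].
move=> [f1 f2 f3] [g1 g2 g3].
split=> *.
- by rewrite a1 b1 c1 d1 f1 g1; ring.
- by rewrite a2 b2 c2 d2 f2 g2; ring.
- by rewrite a3 b3 c3 d3 f3 g3; ring.
Qed.

Lemma alt3_scale (T : Type) (G H : T -> T -> T -> R) c :
  (forall u v w, G u v w = c * H u v w) ->
  forall u v w, alt3 G u v w = c * alt3 H u v w.
Proof. by move=> GH u v w; rewrite /alt3 !GH; ring. Qed.

Lemma alt33_trilinear G (Z : 'M[R]_3) :
  (forall y1 y2 y3, trilinear (fun x1 x2 x3 => G x1 y1 x2 y2 x3 y3)) ->
  (forall x1 x2 x3, trilinear (fun y1 y2 y3 => G x1 y1 x2 y2 x3 y3)) ->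
  alt33 G (col 0 Z) (col 1 Z) (col 2%:R Z) (col 0 Z) (col 1 Z) (col 2%:R Z) =
  \det Z ^+ 2 *
  alt33 G (e3 R 0) (e3 R 1) (e3 R 2%:R) (e3 R 0) (e3 R 1) (e3 R 2%:R).
Proof.
move=> Gx Gy; rewrite alt33C alt3_trilinear; last exact: alt3_trily.
rewrite -alt33C expr2 -mulrA; congr (_ * _).
have E y1 y2 y3 := alt3_trilinear Z (Gx y1 y2 y3).
have := alt3_scale E (e3 R 0) (e3 R 1) (e3 R 2%:R).
by rewrite (alt33C G (e3 R 0)) => <-; rewrite alt33C.
Qed.

Lemma alt33_tr_QBQB_col a l m (Z : 'M[R]_3) :
  alt33 (tr_QBQB a l m)
    (col 0 Z) (col 1 Z) (col 2%:R Z) (col 0 Z) (col 1 Z) (col 2%:R Z)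
  = - 144%:R * l * \det Z ^+ 2.
Proof.
rewrite alt33_trilinear; [|exact: tr_QBQB_trilinear_l|exact:
  tr_QBQB_trilinear_r].
rewrite (alt33_swap (@tr_QBQBE a l m)) alt33_tr_KJKJ.
by ring.
Qed.

End SixBySix.

(** * Hessians of cubics in Weierstrass form *)

Section Cubic.
Variable F : fieldType.
Implicit Types (a b c : F) (u v w : 'cV[F]_3) (A B Z : 'M[F]_3).

(** The third difference of a cubic form is its full polarisation, which is the bilinear form of the
    Hessian matrix. Defining it on functions rather than on polynomials makes [hess_comp] valid over
    any field, finite or not. *)
Definition pol3 (f : 'cV[F]_3 -> F) u v w :=
  f (u + v + w) - f (u + v) - f (u + w) - f (v + w) + f u + f v + f w.

Definition is_hess (f : 'cV[F]_3 -> F) (H : 'cV[F]_3 -> 'M[F]_3) :=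
  forall u v w, pol3 f u v w = (v^T *m H u *m w) 0 0.

Lemma mx_bilin_inj n (A B : 'M[F]_n) :
  (forall v w : 'cV[F]_n, (v^T *m A *m w) 0 0 = (v^T *m B *m w) 0 0) -> A = B.
Proof.
move=> AB; apply/matrixP => i j.
have:= AB (delta_mx i 0) (delta_mx j 0).
by rewrite -!colE !trmx_delta -!rowE !mxE.
Qed.

Lemma hess_comp f f' H H' c Z : is_hess f H -> is_hess f' H' ->
  (forall u, f' u = c * f (Z *m u)) ->
  forall u, H' u = c *: (Z^T *m H (Z *m u) *m Z).
Proof.
move=> Hf Hf' E u; apply: mx_bilin_inj => v w.
rewrite -Hf' -scalemxAr -scalemxAl [RHS]mxE !mulmxA -trmx_mul.
rewrite -(mulmxA _ Z w) -Hf.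
by rewrite /pol3 !E -!mulmxDr; ring.
Qed.

Lemma adj_mul3 A B : \adj (A *m B) = \adj B *m \adj A.
Proof.
rewrite !adj3; apply/mx3P; rewrite !(mulmx3, mx3E) /=; ring.
Qed.

Definition cub a b u : F :=
  u 1 0 ^+ 2 * u 2%:R 0 -
  (u 0 0 ^+ 3 + a * (u 0 0 * u 2%:R 0 ^+ 2) + b * u 2%:R 0 ^+ 3).

Definition cubH a b u : 'M[F]_3 :=
  let x := u 0 0 in let y := u 1 0 in let z := u 2%:R 0 in
  mx3 [:: [:: - 6%:R * x; 0; - 2%:R * a * z];
          [:: 0; 2%:R * z; 2%:R * y];
          [:: - 2%:R * a * z; 2%:R * y; - 2%:R * a * x - 6%:R * b * z]].

(** The Hessian determinant of [cub], expanded. *)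
Definition cubh a b u : F :=
  let x := u 0 0 in let y := u 1 0 in let z := u 2%:R 0 in
  8%:R * (3%:R * a * x ^+ 2 * z + 9%:R * b * x * z ^+ 2 + 3%:R * x * y ^+ 2
   - a ^+ 2 * z ^+ 3).

Definition cubhH a b u : 'M[F]_3 :=
  let x := u 0 0 in let y := u 1 0 in let z := u 2%:R 0 in
  8%:R *: mx3 [:: [:: 6%:R * a * z; 6%:R * y; 6%:R * a * x + 18%:R * b * z];
          [:: 6%:R * y; 6%:R * x; 0];
          [:: 6%:R * a * x + 18%:R * b * z; 0;
              18%:R * b * x - 6%:R * a ^+ 2 * z]].

Lemma bilin3 A v w : (v^T *m A *m w) 0 0 =
  (v 0 0 * A 0 0 + v 1 0 * A 1 0 + v 2%:R 0 * A 2%:R 0) * w 0 0 +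
  (v 0 0 * A 0 1 + v 1 0 * A 1 1 + v 2%:R 0 * A 2%:R 1) * w 1 0 +
  (v 0 0 * A 0 2%:R + v 1 0 * A 1 2%:R + v 2%:R 0 * A 2%:R 2%:R) * w 2%:R 0.
Proof. by rewrite !mulmx3 ![v^T _ _]mxE. Qed.

Lemma cub_hess a b : is_hess (cub a b) (cubH a b).
Proof.
move=> u v w; rewrite bilin3 /pol3 /cub !(mx3E, mxE) /=.
by ring.
Qed.

Lemma det_cubH a b u : \det (cubH a b u) = cubh a b u.
Proof. by rewrite det3 !mx3E /cubh /=; ring. Qed.

Lemma cubh_hess a b : is_hess (cubh a b) (cubhH a b).
Proof.
move=> u v w; rewrite bilin3 /pol3 /cubh /cubhH !(mx3E, mxE) /=.
by ring.
Qed.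

(* The Aronhold invariants of the cubic, proportional to [a] and [b],
  are read off
   the mixed Hessians of the cubic and its Hessian. *)
Lemma cub_S a b u :
  \tr (\adj (cubH a b u) *m cubhH a b u) = - 576%:R * a * cub a b u.
Proof.
by rewrite /cubH /cubhH adj_mx3 -scalemxAr mxtraceZ mul_mx3 tr_mx3 /cub; ring.
Qed.

(** The traces of [\adj A *m B] and [A *m \adj B] are the coefficients of t and t^2 in det (A + t
    B): here, in the Hessian determinant of f + t h, where h is the Hessian of f. *)
Lemma cub_T a b u :
  \tr (cubH a b u *m \adj (cubhH a b u)) =
  576%:R * (a * cubh a b u + 72%:R * b * cub a b u).
Proof.
rewrite /cubH /cubhH adjZ adj_mx3 -scalemxAr mxtraceZ mul_mx3 tr_mx3.
by rewrite /cub /cubh /=; ring.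
Qed.

(** Hessians are covariant: H' = c Z^T H(Z u) Z, and h' = c^3 (det Z)^2 h(Z u). Inserting this in
    [cub_S] multiplies the trace by c^5 (det Z)^4, in [cub_T] by c^7 (det Z)^6; in the latter the
    terms in h cancel by the formula for a'. *)
Lemma cub_equiv a b a' b' c Z :
  2%:R != 0 :> F -> 3%:R != 0 :> F -> c != 0 -> \det Z != 0 ->
  (forall u, cub a' b' u = c * cub a b (Z *m u)) ->
  a' = (c * \det Z) ^+ 4 * a /\ b' = (c * \det Z) ^+ 6 * b.
Proof.
move=> nz2 nz3 nzc nzZ E; set d := \det Z.
have EH u := hess_comp (@cub_hess a b) (@cub_hess a' b') E u.
have Eh u : cubh a' b' u = (c ^+ 3 * d ^+ 2) * cubh a b (Z *m u).
  rewrite -!det_cubH EH detZ !det_mulmx det_tr -/d; ring.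
have EhH u := hess_comp (@cubh_hess a b) (@cubh_hess a' b') Eh u.
have uZ : Z \in unitmx by rewrite unitmxE unitfE.
(* This puts [Z *m u] at (1, 0, 0), where the cubic takes the value -1 and can be cancelled. *)
pose u := invmx Z *m e3 F 0.
have Zu : Z *m u = e3 F 0 by rewrite mulKVmx.
have f1 : cub a b (Z *m u) = -1.
  by rewrite Zu /cub !mxE /=; ring.
have trZ1 A B : \tr (\adj (Z^T *m A *m Z) *m (Z^T *m B *m Z)) =
    d ^+ 2 * \tr (\adj A *m B).
  rewrite !adj_mul3 -!mulmxA [_ *m (Z^T *m _)]mulmxA mul_adj_mx det_tr.
  rewrite mul_scalar_mx -!scalemxAr linearZ /= mxtrace_mulC -!mulmxA.
  by rewrite mul_mx_adj mul_mx_scalar -scalemxAr linearZ mulrA.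
have trZ2 A B : \tr ((Z^T *m B *m Z) *m \adj (Z^T *m A *m Z)) =
    d ^+ 2 * \tr (B *m \adj A).
  by rewrite mxtrace_mulC trZ1 mxtrace_mulC.
have n6 : 576%:R != 0 :> F.
  by rewrite (_ : 576 = 2 ^ 6 * 3 ^ 2)%N // natrM !natrX mulf_neq0 ?expf_neq0.
have n72 : 72%:R != 0 :> F.
  by rewrite (_ : 72 = 2 ^ 3 * 3 ^ 2)%N // natrM !natrX mulf_neq0 ?expf_neq0.
have S : a' = (c * d) ^+ 4 * a.
  have := cub_S a' b' u; rewrite EhH EH -scalemxAr adjZ -scalemxAl !mxtraceZ /=.
  rewrite trZ1 cub_S E f1 => e; apply: (mulfI n6); apply: (mulfI nzc).
  by apply: etrans (etrans _ (esym e)) _; ring.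
split=> //.
have := cub_T a' b' u; rewrite EhH EH -scalemxAl adjZ -scalemxAr !mxtraceZ /=.
rewrite trZ2 cub_T Eh E f1 S => e; apply: (mulfI n72); apply: (mulfI n6).
apply: (mulfI nzc); apply/eqP; rewrite -subr_eq0; apply/eqP.
move/eqP: e; rewrite -subr_eq0 => /eqP <-; ring.
Qed.

End Cubic.

(** * Equivalent pencils *)

Section MapJ.
Variables (R S : comNzRingType) (f : {rmorphism R -> S}).

Lemma map_e3 i : map_mx f (e3 R i) = e3 S i.
Proof. by rewrite map_delta_mx. Qed.

Lemma map_Jm a l m y :
  map_mx f (Jm a l m y) = Jm (f a) (f l) (f m) (map_mx f y).
Proof.
by apply/mx3P; rewrite !(mxE, mx3E) /= ?mxE;
  rewrite ?(rmorph0, rmorphB, rmorphD, rmorphN, rmorphM, rmorphXn).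
Qed.

Lemma map_skew_block A :
  map_mx f (skew_block A : 'M_(3 + 3)) = skew_block (map_mx f A).
Proof. by rewrite map_block_mx !map_mx0 map_mxN -map_trmx. Qed.

Lemma map_Bm a l m y :
  map_mx f (Bm a l m y) = Bm (f a) (f l) (f m) (map_mx f y).
Proof. by rewrite map_skew_block map_Jm. Qed.

Lemma map_Qm a l m y :
  map_mx f (Qm a l m y) = Qm (f a) (f l) (f m) (map_mx f y).
Proof. by rewrite map_skew_block map_mxN -map_trmx map_mx_adj map_Jm. Qed.

Lemma map_Qm_eq a l m y a' l' m' y' :
  f a = a' -> f l = l' -> f m = m' -> map_mx f y = y' ->
  map_mx f (Qm a l m y) = Qm a' l' m' y'.
Proof. by rewrite map_Qm => -> -> -> ->. Qed.

End MapJ.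

Lemma mul_Bm_Qm (R : comNzRingType) (a l m : R) y :
  Bm a l m y *m Qm a l m y = (\det (Jm a l m y))%:M.
Proof.
rewrite /Qm /Bm mul_skew_block mulmxN opprK -trmx_mul mul_adj_mx.
rewrite raddfN /= trmxK mulmxN opprK mul_mx_adj tr_scalar_mx.
by rewrite -scalar_mx_block.
Qed.

(** For invertible matrices this is Q1 = f B1^-1 and Q2 = e f B2^-1 with B2 = X^T B1 X. Over a
    domain, X is cancelled by multiplying with its adjugate, and f at the end. *)
Lemma congr_inverse (R : idomainType) n (X B1 B2 Q1 Q2 : 'M[R]_n) (f e : R) :
  \det X != 0 -> f != 0 -> X^T *m B1 *m X = B2 -> B1 *m Q1 = f%:M ->
  Q2 *m B2 = (e * f)%:M -> X *m Q2 *m X^T = e *: Q1.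
Proof.
move=> nzX nzf E BQ QB; have mulIX (M : 'M_n) : M *m X = 0 -> M = 0.
  move=> /(congr1 (mulmx^~ (\adj X))); rewrite mul0mx -mulmxA mul_mx_adj.
  rewrite mul_mx_scalar => /matrixP MX; apply/matrixP => i j.
  have := MX i j; rewrite !mxE => /eqP; rewrite mulf_eq0 (negPf nzX).
  by move/eqP.
have {}E : X *m Q2 *m X^T *m B1 = (e * f)%:M.
  apply/eqP; rewrite -subr_eq0; apply/eqP/mulIX.
  rewrite mulmxBl -!mulmxA (mulmxA X^T) E QB.
  by rewrite mul_mx_scalar mul_scalar_mx subrr.
have := congr1 (mulmx^~ Q1) E; rewrite -mulmxA BQ mul_mx_scalar.
rewrite mul_scalar_mx mulrC -scalerA => /matrixP {}E.
by apply/matrixP => i j; have := E i j; rewrite !mxE => /(mulfI nzf).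
Qed.

Lemma cV3_lin_ext (R : comNzRingType) (V : lmodType R) (f g : 'cV[R]_3 -> V) :
  (forall c x y, f (c *: x + y) = c *: f x + f y) ->
  (forall c x y, g (c *: x + y) = c *: g x + g y) ->
  (forall i, f (e3 R i) = g (e3 R i)) -> f =1 g.
Proof.
have lin0 (h : 'cV[R]_3 -> V) :
  (forall c x y, h (c *: x + y) = c *: h x + h y) -> h 0 = 0.
  by move/(_ (-1) 0 0); rewrite scaler0 addr0 scaleN1r addNr.
move=> lf lg fg x; rewrite [x]cV3_sum -[x 2%:R 0 *: _]addr0.
by rewrite !lf !lg !fg (lin0 f lf) (lin0 g lg).
Qed.

Lemma congr_mx_lin (R : comNzRingType) n (X A B : 'M[R]_n) c :
  X^T *m (c *: A + B) *m X = c *: (X^T *m A *m X) + X^T *m B *m X.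
Proof. by rewrite mulmxDr mulmxDl -scalemxAr -scalemxAl. Qed.

Lemma alt33_map (T : Type) (R : comNzRingType) (g : T -> T) (c : R)
    (G H : T -> T -> T -> T -> T -> T -> R) :
  (forall x1 y1 x2 y2 x3 y3, c * G x1 y1 x2 y2 x3 y3 =
     H (g x1) (g y1) (g x2) (g y2) (g x3) (g y3)) ->
  forall x1 x2 x3 y1 y2 y3, c * alt33 G x1 x2 x3 y1 y2 y3 =
     alt33 H (g x1) (g x2) (g x3) (g y1) (g y2) (g y3).
Proof. by move=> GH *; rewrite /alt33 /alt3 -!GH; ring. Qed.

Section Equivalence.
Variables (F : fieldType) (a l m a' l' m' : F).
Variables (X : 'M[F]_(3 + 3)) (Z : 'M[F]_3).
Hypotheses (nzX : \det X != 0) (nzZ : \det Z != 0).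
Hypothesis XZ : forall y, X^T *m Bm a' l' m' y *m X = Bm a l m (Z *m y).

Let R := {mpoly F[3]}.
(* The identities for the pencils are first proved at the generic point, where
   the Pfaffian is not a zero divisor, and then specialised. *)
Let gy : 'cV[R]_3 := \col_i 'X_i.

Lemma map_gy (y : 'cV[F]_3) : map_mx (meval (fun i => y i 0)) gy = y.
Proof. by apply/colP => i; rewrite !mxE mevalXU. Qed.

Lemma generic_congr (C := @mpolyC 3 F) :
  (map_mx C X)^T *m Bm (C a') (C l') (C m') gy *m map_mx C X
  = Bm (C a) (C l) (C m) (map_mx C Z *m gy).
Proof.
have EX i : (map_mx C X)^T *m Bm (C a') (C l') (C m') (e3 R i) *m map_mx C X
  = Bm (C a) (C l) (C m) (map_mx C Z *m e3 R i).
  by rewrite -!(map_e3 C) -map_Bm map_trmx -!map_mxM XZ map_Bm map_mxM.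
have: (fun y => (map_mx C X)^T *m Bm (C a') (C l') (C m') y *m map_mx C X) =1
  (fun y => Bm (C a) (C l) (C m) (map_mx C Z *m y)); last by apply.
apply: cV3_lin_ext => [c x y|c x y|i]; last exact: EX.
  by rewrite Bm_lin congr_mx_lin.
by rewrite mulmxDr -scalemxAr Bm_lin.
Qed.

(** The determinant of [skew_block] is a square, so comparing determinants yields det J(Z y) = e det
    J'(y) up to a sign in e. As the comparison takes place in the domain of polynomials, the sign
    does not depend on y. It may remain undetermined: of e itself, only that it is nonzero is needed
    later. *)
Lemma Bm_equiv : exists2 e : F, e ^+ 2 = \det X ^+ 2 &
  (forall y, \det (Jm a l m (Z *m y)) = e * \det (Jm a' l' m' y)) /\
  (forall y, X *m Qm a l m (Z *m y) *m X^T = e *: Qm a' l' m' y).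
Proof.
pose C := @mpolyC 3 F.
pose f1 := \det (Jm (C a') (C l') (C m') gy).
pose f2 := \det (Jm (C a) (C l) (C m) (map_mx C Z *m gy)).
have ev1 (y : 'cV_3) : meval (fun i => y i 0) f1 = \det (Jm a' l' m' y).
  by rewrite -det_map_mx map_Jm map_gy /= !mevalC.
have ev2 (y : 'cV_3) : meval (fun i => y i 0) f2 = \det (Jm a l m (Z *m y)).
  rewrite -det_map_mx map_Jm map_mxM map_gy /= !mevalC;
    congr (\det (Jm _ _ _ (_ *m _))).
  by apply/matrixP => i j; rewrite !mxE mevalC.
have nz1 : f1 != 0.
  apply/eqP => f10; have := ev1 (e3 F 0); rewrite f10 raddf0 det_Jm !mxE /=.
  by move/eqP; rewrite eq_sym (_ : _ - _ = -1) ?oppr_eq0 ?oner_eq0 //; ring.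
have [e e2 ef] : exists2 e : F, e ^+ 2 = \det X ^+ 2 & f2 = C e * f1.
  have := congr1 determinant generic_congr.
  rewrite !det_mulmx det_tr !det_skew_block -/f1 -/f2 det_map_mx.
  rewrite mulrAC -expr2 -exprMn => /eqP; rewrite eq_sym eqf_sqr.
  case/orP => /eqP ->; first by exists (\det X).
  by exists (- \det X); rewrite ?sqrrN // /C mpolyCN mulNr.
exists e => //; split=> y; first by rewrite -ev2 ef rmorphM /= mevalC ev1.
have nzCX : \det (map_mx C X) != 0 by rewrite det_map_mx mpolyC_eq0.
have Q2B : Qm (C a) (C l) (C m) (map_mx C Z *m gy) *m
           Bm (C a) (C l) (C m) (map_mx C Z *m gy) = (C e * f1)%:M.
  by rewrite mul_Qm_Bm -ef.
pose ev := meval (fun i => y i 0).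
have mapC n k (M : 'M[F]_(n, k)) : map_mx ev (map_mx C M) = M.
  by apply/matrixP => i j; rewrite !mxE /ev mevalC.
have mXQ (M N : 'M[R]_(3 + 3)) :
    map_mx C X *m M *m (map_mx C X)^T = C e *: N ->
    X *m map_mx ev M *m X^T = e *: map_mx ev N.
  move/(congr1 (map_mx ev)).
  by rewrite map_mxZ !map_mxM -map_trmx !mapC /ev /= mevalC.
have mQ : map_mx ev (Qm (C a) (C l) (C m) (map_mx C Z *m gy))
   = Qm a l m (Z *m y).
  apply: map_Qm_eq; try exact: mevalC.
  by rewrite map_mxM mapC map_gy.
have mQ' : map_mx ev (Qm (C a') (C l') (C m') gy) = Qm a' l' m' y.
  by apply: map_Qm_eq; try exact: mevalC; exact: map_gy.
rewrite -mQ -mQ'; apply: mXQ.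
exact: congr_inverse nzCX nz1 generic_congr (mul_Bm_Qm _ _ _ _) Q2B.
Qed.

(** Substituting X^T B' X for B, every X is adjacent to a Q up to cyclic permutation, and each of
    the two X Q X^T yields one factor e. *)
Lemma tr_QBQB_equiv e x1 y1 x2 y2 x3 y3 :
  (forall y, X *m Qm a l m (Z *m y) *m X^T = e *: Qm a' l' m' y) ->
  e ^+ 2 * tr_QBQB a' l' m' x1 y1 x2 y2 x3 y3 =
  tr_QBQB a l m (Z *m x1) (Z *m y1) (Z *m x2) (Z *m y2) (Z *m x3) (Z *m y3).
Proof.
move=> EQ.
have XB (A B C A' B' C' : 'M[F]_(3 + 3)) : X *m A *m X^T = e *: A' ->
    X *m B *m X^T = e *: B' -> X *m C *m X^T = e *: C' ->
    X *m (A - B - C) *m X^T = e *: (A' - B' - C').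
  by move=> EA EB EC; rewrite !mulmxBr !mulmxBl EA EB EC !scalerBr.
have EQp x y : X *m Qp a l m (Z *m x) (Z *m y) *m X^T = e *: Qp a' l' m' x y.
  rewrite (Qp_polar a l) (Qp_polar a' l') -(mulmxDr Z).
  by apply: XB; apply: EQ.
have trX (A A' B C C' D : 'M[F]_(3 + 3)) :
    X *m A *m X^T = e *: A' -> X *m C *m X^T = e *: C' ->
    e ^+ 2 * tr4 A' B C' D = tr4 A (X^T *m B *m X) C (X^T *m D *m X).
  move=> EA EC; rewrite /tr4.
  transitivity (\tr ((X *m A *m X^T) *m B *m ((X *m C *m X^T) *m D))).
    by rewrite EA EC -!scalemxAl -!scalemxAr !mxtraceZ mulrA expr2.
  by rewrite -!mulmxA mxtrace_mulC -!mulmxA.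
by rewrite /tr_QBQB (trX _ _ _ _ _ _ (EQp _ _) (EQp _ _)) !XZ.
Qed.

Lemma params_equiv : 2%:R != 0 :> F -> 3%:R != 0 :> F ->
  exists2 u : F, u != 0 &
  [/\ a' = u ^+ 4 * a, l' = u ^+ 2 * l & m' = u ^+ 3 * m].
Proof.
move=> nz2 nz3; have [e e2 [Ef EQ]] := Bm_equiv.
have nze : e != 0 by rewrite -sqrf_eq0 e2 sqrf_eq0.
pose d := \det Z.
pose b := m ^+ 2 - l ^+ 3 - a * l; pose b' := m' ^+ 2 - l' ^+ 3 - a' * l'.
have Ec u : cub a' b' u = e^-1 * cub a b (Z *m u).
  by apply: (mulfI nze); rewrite mulVKf // -[LHS]/(e * (_ - _)) -det_Jm -Ef
    det_Jm.
have [Ea Eb] := cub_equiv nz2 nz3 (invr_neq0 nze) nzZ Ec.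
have El : l' = (e^-1 * d) ^+ 2 * l.
  have n144 : 144%:R != 0 :> F.
    by rewrite (_ : 144 = 2 ^ 4 * 3 ^ 2)%N // natrM !natrX mulf_neq0 ?expf_neq0.
  have := alt33_tr_QBQB_col a l m Z.
  rewrite !colE -(alt33_map (fun x1 y1 x2 y2 x3 y3 =>
    tr_QBQB_equiv x1 y1 x2 y2 x3 y3 EQ)).
  rewrite (alt33_swap (@tr_QBQBE _ a' l' m')) alt33_tr_KJKJ -/d => E.
  apply: (mulfI n144); apply: (mulfI nze); apply: (mulfI nze).
  apply: oppr_inj; apply: etrans (etrans _ E) _; first by ring.
  by field.
have [v ev] : exists v, v = e^-1 * d by exists (e^-1 * d).
have nzv : v != 0 by rewrite ev mulf_neq0 // invr_eq0.
rewrite -/d -ev in Ea Eb El.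
have : m' ^+ 2 == (v ^+ 3 * m) ^+ 2.
  have -> : m' ^+ 2 = b' + l' ^+ 3 + a' * l' by rewrite /b'; ring.
  by rewrite Eb Ea El /b; apply/eqP; ring.
rewrite eqf_sqr => /orP[] /eqP em; first by exists v.
exists (- v); first by rewrite oppr_eq0.
by rewrite Ea El em; split; ring.
Qed.

End Equivalence.

(** * From groups to pencils *)

Section BaerIso.
Variables (F : finFieldType) (n m : nat) (B B' : 'I_m -> 'M[F]_n).
Hypothesis nz2 : 2%:R != 0 :> F.
Hypothesis altB : forall i, (B i)^T = - B i.
Hypothesis altB' : forall i, (B' i)^T = - B' i.
Hypothesis ndB : forall u, (forall v, tensor B u v = 0) -> u = 0.
Hypothesis ndB' : forall u, (forall v, tensor B' u v = 0) -> u = 0.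

Lemma tensor_alt (C : 'I_m -> 'M[F]_n) : (forall i, (C i)^T = - C i) ->
  forall u v, tensor C v u = - tensor C u v.
Proof.
move=> altC u v; apply/colP => i; rewrite [RHS]mxE !tensorE.
have -> : v^T *m C i *m u = (u^T *m (C i)^T *m v)^T.
  by rewrite !trmx_mul !trmxK mulmxA.
by rewrite mxE altC mulmxN mulNmx mxE.
Qed.

Lemma baer_mulE (C : 'I_m -> 'M[F]_n) (x y : baer C) :
  (x * y)%g = (x.1 + y.1, x.2 + y.2 + 2%:R^-1 *: tensor C x.1 y.1) :> baer C.
Proof. by []. Qed.

Lemma eq_oppr0 (V : lmodType F) (w : V) : w = - w -> w = 0.
Proof.
move=> /eqP; rewrite -addr_eq0 -mulr2n -scaler_nat scaler_eq0 (negPf nz2).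
by move/eqP.
Qed.

Lemma scale_halfD (V : lmodType F) (w : V) : 2%:R^-1 *: w + 2%:R^-1 *: w = w.
Proof. by rewrite -scalerDl -mulr2n -[X in X *+ 2]mulr1 -mulrnAr mulVf //
  scale1r. Qed.

(** The commutator of (u, w) and (v, w') is (0, t(u, v)). By nondegeneracy of the tensors the centre
    consists of the elements (0, w), so an isomorphism induces maps on the quotient and on the
    centre that respect commutators. The second component of [f (u, 0)] is arbitrary, but
    commutators do not see it. *)
Lemma baer_isog_pair : [set: baer B] \isog [set: baer B'] ->
  exists alpha : 'cV[F]_n -> 'cV[F]_n, exists beta : 'cV[F]_m -> 'cV[F]_m,
  [/\ {morph alpha : u v / u + v}, {morph beta : u v / u + v}, injective alpha,
      injective beta
    & forall u v, beta (tensor B u v) = tensor B' (alpha u) (alpha v)].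
Proof.
case/isogP => f injf im_f.
have fM (x y : baer B) : f (x * y)%g = (f x * f y)%g by rewrite morphM ?inE.
have f_inj : injective f by move=> x y; move/injmP: injf; apply; rewrite inE.
have f_surj y : exists x, f x = y.
  have : y \in (f @* [set: baer B])%g by rewrite im_f inE.
  by case/morphimP => x _ _ ->; exists x.
have t0l (C : 'I_m -> 'M[F]_n) v : tensor C 0 v = 0 := tensor0l C v.
have t0r (C : 'I_m -> 'M[F]_n) u : tensor C u 0 = 0.
  by apply/colP => i; rewrite tensorE mulmx0 !mxE.
(* As (0, w) is central and f is onto, the first component of its image pairs to 0 with every
   vector. *)
have fc w : (f (0, w)).1 = 0.
  apply: ndB' => v; apply: eq_oppr0.
  have [x fx] := f_surj (v, 0).
  have cx : (((0, w) : baer B) * x = x * ((0, w) : baer B))%g.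
    rewrite !baer_mulE /= t0l t0r; congr pair; first by rewrite addrC.
    by rewrite (addrC w).
  have /(congr1 snd) := congr1 f cx; rewrite !fM fx !baer_mulE /=.
  rewrite (addrC (f _).2) => /addrI /(scalerI (invr_neq0 nz2)) E.
  by rewrite {1}E tensor_alt.
have fuw u w : ((u, w) : baer B) = (((u, 0) : baer B) * ((0, w) : baer B))%g.
  by rewrite baer_mulE /= t0r scaler0 !addr0 add0r.
pose alpha u := (f (u, 0)).1; pose beta w := (f (0, w)).2.
have f1 u w : (f (u, w)).1 = alpha u.
  by rewrite fuw fM baer_mulE /= fc addr0.
have f0 w : f (0, w) = (0, beta w).
  by move: (fc w); rewrite /beta; case: (f _) => x y /= ->.
have aD : {morph alpha : u v / u + v}.
  move=> u v; rewrite -(f1 (u + v) (0 + 0 + 2%:R^-1 *: tensor B u v)).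
  by rewrite -[f _]/(f (((u, 0) : baer B) * ((v, 0) : baer B))%g) fM.
have bD : {morph beta : u v / u + v}.
  move=> u v; rewrite /beta.
  have -> : ((0, u + v) : baer B) = (((0, u) : baer B) * ((0, v) : baer B))%g.
    by rewrite baer_mulE /= t0l scaler0 !addr0.
  by rewrite fM baer_mulE /= fc t0l scaler0 addr0.
have bt u v : beta (tensor B u v) = tensor B' (alpha u) (alpha v).
  have E : (((u, 0) : baer B) * ((v, 0) : baer B) =
     ((v, 0) : baer B) * ((u, 0) : baer B) * ((0, tensor B u v) : baer B))%g.
    rewrite !baer_mulE /= t0r scaler0 !addr0 !add0r (tensor_alt altB u v).
    congr pair; first by rewrite addrC.
    by rewrite scalerN addrC -{2}(scale_halfD (tensor B u v)) addrK.
  have /(congr1 snd) := congr1 f E; rewrite !fM !baer_mulE /= fc t0r scaler0.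
  rewrite addr0 (tensor_alt altB' (f (u, 0)).1) scalerN => {}E.
  apply: (addrI ((f (v, 0)).2 + (f (u, 0)).2
    - 2%:R^-1 *: tensor B' (f (u, 0)).1 (f (v, 0)).1)).
  rewrite -[X in X = _]E -[X in _ = _ + X]scale_halfD.
  by rewrite addrA subrK (addrC (f (u, 0)).2).
have b_inj : injective beta.
  move=> w w' E; suff : (0, w) = (0, w') :> baer B by case.
  by apply: f_inj; rewrite !f0 E.
have a0 u : alpha u = 0 -> u = 0.
  move=> au0; apply: ndB => v; apply: b_inj.
  by rewrite bt au0 t0l; apply: (addIr (beta 0)); rewrite -bD !add0r.
exists alpha, beta; split=> //.
move=> u v E; apply/eqP; rewrite -subr_eq0; apply/eqP/a0.
by apply: (addIr (alpha v)); rewrite -aD subrK add0r.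
Qed.

End BaerIso.

Local Ltac entry E known :=
  let e := fresh "e" in have e := E; move: e; rewrite !mx3E /= !mxE /=
    !(known, mulr0, mul0r, mulr1, mul1r, addr0, add0r, oppr0, subr0, sub0r,
      mulrN1) => e;
  first [exact: e | exact: esym e | by apply: oppr_inj;
    rewrite oppr0 | move: e].

(** * The centroid of the commutator tensor *)

Section Tensor.
Variables (F : finFieldType) (a l m : F).

Definition Bc (i : 'I_3) : 'M[F]_(3 + 3) := Bm a l m (e3 F i).

Local Notation J := (fun i => Jm a l m (e3 F i)).
Local Notation t := (tensor Bc).

Lemma Bc_alt i : (Bc i)^T = - Bc i.
Proof.
rewrite /Bc /Bm /skew_block tr_block_mx !trmx0 opp_block_mx !oppr0 opprK.
by rewrite raddfN /= trmxK.
Qed.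

Lemma tensor_Bc_block (u1 u2 v1 v2 : 'cV[F]_3) i :
  t (col_mx u1 u2) (col_mx v1 v2) i 0 =
  (u1^T *m J i *m v2) 0 0 - (v1^T *m J i *m u2) 0 0.
Proof.
rewrite tensorE tr_col_mx mul_row_block !mulmx0 add0r addr0 mul_row_col.
have -> : v1^T *m J i *m u2 = (u2^T *m (J i)^T *m v1)^T.
  by rewrite !trmx_mul !trmxK mulmxA.
rewrite addrC mulmxN mulNmx.
move: (_ *m v2) (_ *m v1) => x y; by rewrite !mxE.
Qed.

Lemma J0_unit : J 0 \in unitmx.
Proof.
rewrite unitmxE det_Jm !mxE /= (_ : _ - _ = -1) ?unitrN1 //; ring.
Qed.

(** A single member of the pencil suffices: (1 : 0 : 0) is not on the cubic, so [J 0] is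
    invertible. *)
Lemma tensor_Bc_eq0 u : (forall v, t u v = 0) -> u = 0.
Proof.
rewrite -[u]vsubmxK; set u1 := usubmx _; set u2 := dsubmx _ => tu0.
suff [-> ->] : u1 = 0 /\ u2 = 0 by exact: col_mx0.
split.
- have E : u1^T *m J 0 = 0.
    apply/rowP => j; have /colP/(_ 0) := tu0 (col_mx 0 (delta_mx j 0)).
    by rewrite tensor_Bc_block -colE trmx0 !mul0mx !mxE subr0.
  by apply: trmx_inj; rewrite -(mulmxK J0_unit u1^T) E mul0mx trmx0.
- have E : J 0 *m u2 = 0.
    apply/colP => j; have /colP/(_ 0) := tu0 (col_mx (delta_mx j 0) 0).
    rewrite tensor_Bc_block mulmx0 trmx_delta -mulmxA -rowE !mxE sub0r => /eqP.
    by rewrite oppr_eq0 => /eqP e; exact: e.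
  by rewrite -(mulKmx J0_unit u2) E mulmx0.
Qed.

(** Serves to transfer semilinearity from [alpha] to [beta]: a scalar in front of a basis vector can
    be moved into an argument of the tensor. *)
Lemma tensor_Bc_e3 j : exists u, exists v, t u v = e3 F j.
Proof.
pose c3 (x y z : F) : 'cV_3 := \col_i nth 0 [:: x; y; z] i.
have tE u v : t (col_mx u 0) (col_mx 0 v) =
    \col_i (u^T *m J i *m v) 0 0.
  by apply/colP => i; rewrite tensor_Bc_block trmx0 !mul0mx [X in _ - X]mxE
    subr0 [RHS]mxE.
case: (ord3P j) => ->.
- exists (col_mx (c3 0 1 0) 0), (col_mx 0 (c3 0 0 1)); rewrite tE.
  by apply/colP => i; case: (ord3P i) => ->; rewrite mxE bilin3 !mxE /=; ring.
- exists (col_mx (c3 1 0 1) 0), (col_mx 0 (c3 (-1) 1 (l - m))); rewrite tE.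
  by apply/colP => i; case: (ord3P i) => ->; rewrite mxE bilin3 !mxE /=; ring.
- exists (col_mx (c3 0 0 1) 0), (col_mx 0 (c3 0 0 (-1))); rewrite tE.
  by apply/colP => i; case: (ord3P i) => ->; rewrite mxE bilin3 !mxE /=; ring.
Qed.

(** A sparse linear system in 18 unknowns; the equations are ordered so that each one determines a
    new entry from those already known. *)
Lemma intertwiner_scalar (M N : 'M[F]_3) :
  (forall i, M *m J i = J i *m N) -> exists s, M = s%:M /\ N = s%:M.
Proof.
move=> MN; exists (M 0 0).
have H i p q : M p 0 * J i 0 q + M p 1 * J i 1 q + M p 2%:R * J i 2%:R q =
    J i p 0 * N 0 q + J i p 1 * N 1 q + J i p 2%:R * N 2%:R q.
  by rewrite -!mulmx3 MN.
have N12 : N 1 2%:R = 0 by entry (H 1 0 2%:R) mulr0.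
have N02 : N 0 2%:R = 0 by entry (H 1 1 2%:R) mulr0.
have M20 : M 2%:R 0 = 0 by entry (H 1 2%:R 1) mulr0.
have M21 : M 2%:R 1 = 0 by entry (H 1 2%:R 0) mulr0.
have M01 : M 0 1 = 0 by entry (H 0 0 2%:R) (N02).
have N10 : N 1 0 = 0 by entry (H 1 0 0) (M01).
have N11 : N 1 1 = M 0 0 by entry (H 1 0 1) mulr0.
have N00 : N 0 0 = M 0 0 by entry (H 0 0 0) mulr0.
have M11 : M 1 1 = M 0 0 by entry (H 1 1 0) (N00).
have N22 : N 2%:R 2%:R = M 0 0 by entry (H 0 1 2%:R) (N12, M11).
have M22 : M 2%:R 2%:R = M 0 0 by entry (H 0 2%:R 1) (M21, N11).
have M02 : M 0 2%:R = 0 by entry (H 2%:R 0 2%:R) (N12, N02).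
have N01 : N 0 1 = 0 by entry (H 0 0 1) (M01, M02).
have M10 : M 1 0 = 0 by entry (H 1 1 1) (N01).
have M12 : M 1 2%:R = 0 by entry (H 2%:R 1 2%:R) (N12, N02).
have N20 : N 2%:R 0 = 0 by entry (H 0 1 0) (N10, M10).
have N21 : N 2%:R 1 = 0.
  apply: (addrI (l * M 0 0)); rewrite addr0.
  by entry (H 0 1 1) (M11, M12, N11); rewrite mulrC => <-.
by split; apply/mx3P; rewrite !mxE /= ?mulr1n ?mulr0n.
Qed.

(* The second hypothesis excludes the intertwiners of [J] and [- J^T]. *)
Lemma centroid_scalar (A : 'M[F]_(3 + 3)) :
  (forall u v, t (A *m u) v = t u (A *m v)) ->
  (forall u v, t u v = 0 -> t (A *m u) v = 0) ->
  exists s, A = s%:M.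
Proof.
have z00 : (0 : 'M[F]_1) 0 0 = 0 by rewrite mxE.
rewrite -[A]submxK; set A1 := ulsubmx A; set A2 := ursubmx A.
set A3 := dlsubmx A; set A4 := drsubmx A => selfA zA.
(* Both summands of F^3 + F^3 are totally isotropic, and by the second hypothesis each remains
   orthogonal to its image under A. As [J 0] is invertible, the off-diagonal blocks vanish. *)
have A30 : A3 = 0.
  suff E : A3^T *m (J 0)^T = 0.
    apply: trmx_inj; rewrite trmx0 -(mulmxK (_ : (J 0)^T \in unitmx) A3^T) ?E
      ?mul0mx //.
    by rewrite unitmx_tr J0_unit.
  apply: mx_bilin_inj => u v; rewrite mulmx0 mul0mx [RHS]mxE.
  have t0 : t (col_mx u 0) (col_mx v 0) = 0.
    by apply/colP => i; rewrite tensor_Bc_block !mulmx0 z00 subrr mxE.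
  move/zA/(congr1 (fun w : 'cV_3 => w 0 0)): t0.
  rewrite mul_block_col !mulmx0 !addr0 tensor_Bc_block mulmx0 z00 sub0r.
  rewrite [RHS]mxE => /eqP; rewrite oppr_eq0 => /eqP <-.
  have -> : v^T *m J 0 *m (A3 *m u) = (u^T *m (A3^T *m (J 0)^T) *m v)^T.
    by rewrite !trmx_mul !trmxK !mulmxA.
  by rewrite [RHS]mxE.
have A20 : A2 = 0.
  suff E : A2^T *m J 0 = 0.
    by apply: trmx_inj; rewrite trmx0 -(mulmxK J0_unit A2^T) E mul0mx.
  apply: mx_bilin_inj => u v; rewrite mulmx0 mul0mx [RHS]mxE.
  have t0 : t (col_mx 0 u) (col_mx 0 v) = 0.
    by apply/colP => i; rewrite tensor_Bc_block trmx0 !mul0mx z00 subrr mxE.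
  move/zA/(congr1 (fun w : 'cV_3 => w 0 0)): t0.
  rewrite mul_block_col !mulmx0 !add0r tensor_Bc_block trmx0 !mul0mx z00 subr0.
  by rewrite [RHS]mxE trmx_mul !mulmxA.
have [s [E1 E4]] : exists s, A1^T = s%:M /\ A4 = s%:M.
  apply: intertwiner_scalar => i; apply: mx_bilin_inj => u v.
  have /(congr1 (fun w : 'cV_3 => w i 0)) := selfA (col_mx u 0) (col_mx 0 v).
  rewrite !mul_block_col A20 A30 !mul0mx !mulmx0 !addr0 !add0r !tensor_Bc_block.
  rewrite !trmx0 !mul0mx z00 !subr0 trmx_mul !mulmxA.
  by [].
exists s; rewrite A20 A30 E4 (_ : A1 = s%:M) -?scalar_mx_block //.
by apply: trmx_inj; rewrite E1 tr_scalar_mx.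
Qed.

End Tensor.

Lemma semilinear_mx (F : fieldType) (sigma : {rmorphism F -> F}) n k
    (g : 'cV[F]_n -> 'cV[F]_k) :
  {morph g : u v / u + v} -> (forall s u, g (s *: u) = sigma s *: g u) ->
  forall u, g u = (\matrix_(i, j) g (delta_mx j 0) i 0) *m map_mx sigma u.
Proof.
move=> gD gZ u; have g0 : g 0 = 0.
  by apply: (addrI (g 0)); rewrite -gD !addr0.
have {1}-> : u = \sum_j u j 0 *: delta_mx j 0.
  by rewrite [LHS]matrix_sum_delta; apply: eq_bigr => j _; rewrite big_ord1.
rewrite (big_morph g gD g0); apply/colP => i.
rewrite summxE [RHS]mxE; apply: eq_bigr => j _.
by rewrite gZ !mxE mulrC.
Qed.

Lemma Bm_sum (R : comNzRingType) (a l m : R) y :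
  Bm a l m y = y 0 0 *: Bm a l m (e3 R 0) + (y 1 0 *: Bm a l m (e3 R 1)
    + y 2%:R 0 *: Bm a l m (e3 R 2%:R)).
Proof.
have B0 : Bm a l m 0 = 0.
  by have := Bm_lin a l m (-1) 0 0; rewrite scaler0 addr0 scaleN1r addNr.
by rewrite {1}[y]cV3_sum -[y 2%:R 0 *: _]addr0 !Bm_lin B0 addr0.
Qed.

(** * Semilinearity of the induced bijections *)

Section IsoParams.
Variables (F : finFieldType) (a l m a' l' m' : F).
Local Notation t := (tensor (Bc a l m)).
Local Notation t' := (tensor (Bc a' l' m')).
Variable alpha : 'cV[F]_(3 + 3) -> 'cV[F]_(3 + 3).
Variable beta : 'cV[F]_3 -> 'cV[F]_3.
Hypotheses (aD : {morph alpha : u v / u + v}) (bD : {morph beta : u v / u + v}).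
Hypotheses (a_inj : injective alpha) (b_inj : injective beta).
Hypothesis bt : forall u v, beta (t u v) = t' (alpha u) (alpha v).

Lemma tensorZl (B : 'I_3 -> 'M[F]_(3 + 3)) s u v : tensor B (s *: u) v =
  s *: tensor B u v.
Proof.
by apply/colP => i; rewrite [RHS]mxE !tensorE linearZ -!scalemxAl mxE.
Qed.

Lemma tensorZr (B : 'I_3 -> 'M[F]_(3 + 3)) s u v : tensor B u (s *: v) =
  s *: tensor B u v.
Proof. by apply/colP => i; rewrite [RHS]mxE !tensorE -scalemxAr mxE. Qed.

Lemma tensor_Bc_inj (u w : 'cV[F]_(3 + 3)) : (forall v, t' u v = t' w v) ->
  u = w.
Proof.
move=> uw; apply/eqP; rewrite -subr_eq0;
  apply/eqP/(@tensor_Bc_eq0 _ a' l' m') => v.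
by rewrite tensorDl tensorNl uw subrr.
Qed.

(** Conjugating the multiplication by s with [alpha] gives an additive map that is self-adjoint for
    t', because s can be moved between the arguments of t. It preserves orthogonality since [beta]
    is injective. Hence it lies in the centroid. *)
Lemma scal_exists s : exists s', forall u, alpha (s *: u) = s' *: alpha u.
Proof.
have [ai aK aiK] := injF_bij a_inj.
have a0 : alpha 0 = 0 by apply: (addrI (alpha 0)); rewrite -aD !addr0.
have b0 : beta 0 = 0 by apply: (addrI (beta 0)); rewrite -bD !addr0.
have aiD : {morph ai : u v / u + v}.
  by move=> u v; apply: a_inj; rewrite aD !aiK.
pose A u := alpha (s *: ai u).
have selfA u v : t' (A u) v = t' u (A v).
  rewrite -{1}[v]aiK -{2}[u]aiK -!bt tensorZl tensorZr //.
have AD : {morph A : u v / u + v}.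
  by move=> u v; rewrite /A aiD scalerDr aD.
(* Self-adjointness makes the additive map [A] linear. *)
have AZ c u : A (c *: u) = c *: A u.
  by apply: tensor_Bc_inj => v; rewrite selfA !tensorZl selfA.
pose N := \matrix_(i, j) A (delta_mx j 0) i 0.
have AE u : A u = N *m u.
  rewrite [LHS](@semilinear_mx F idfun _ _ A AD AZ); congr (_ *m _).
  by apply/matrixP => i j; rewrite mxE.
have [u v|u v uv0|s' Es'] := @centroid_scalar _ a' l' m' N.
- by rewrite -!AE selfA.
- rewrite -AE -(aiK v) -bt tensorZl.
  have -> : t (ai u) (ai v) = 0 by apply: b_inj; rewrite bt !aiK uv0 b0.
  by rewrite scaler0 b0.
exists s' => u; rewrite -{1}[u]aK -[alpha (s *: _)]/(A (alpha u)).
by rewrite AE Es' mul_scalar_mx.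
Qed.

Lemma scal_rmorphism : exists sigma : {rmorphism F -> F},
  forall s u, alpha (s *: u) = sigma s *: alpha u.
Proof.
have [sg sgE] := fin_all_exists scal_exists.
have a0 : alpha 0 = 0 by apply: (addrI (alpha 0)); rewrite -aD !addr0.
pose w := alpha (const_mx 1).
have nzw : w != 0.
  rewrite -a0 (inj_eq a_inj); apply/eqP => /colP/(_ 0)/eqP.
  by rewrite !mxE oner_eq0.
have wI s s' : s *: w = s' *: w -> s = s'.
  move/eqP; rewrite -subr_eq0 -scalerBl scaler_eq0 (negPf nzw) orbF subr_eq0.
  by move/eqP.
have sgB : zmod_morphism sg.
  move=> s s'; apply: wI; rewrite -sgE scalerBl scalerBl -!sgE.
  by apply: (addIr (alpha (s' *: const_mx 1))); rewrite -aD !subrK.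
have sg1 : sg 1 = 1 by apply: wI; rewrite -sgE !scale1r.
have sgM : monoid_morphism sg.
  split=> // s s'; apply: wI; rewrite -sgE -!scalerA.
  by rewrite -!sgE.
pose sZ := GRing.isZmodMorphism.Build F F sg sgB.
pose sM := GRing.isMonoidMorphism.Build F F sg sgM.
by exists (HB.pack_for {rmorphism F -> F} sg sZ sM).
Qed.

Lemma beta_semilinear (sigma : {rmorphism F -> F}) :
  (forall s u, alpha (s *: u) = sigma s *: alpha u) ->
  forall s w, beta (s *: w) = sigma s *: beta w.
Proof.
move=> aZ s w.
have b0 : beta 0 = 0 by apply: (addrI (beta 0)); rewrite -bD !addr0.
have bE c c' j : beta (c * c' *: e3 F j) = sigma c *: beta (c' *: e3 F j).
  have [u [v <-]] := tensor_Bc_e3 a l m j.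
  by rewrite -!tensorZl !bt !aZ !tensorZl rmorphM scalerA.
rewrite [w]cV3_sum !scalerDr !scalerA !bD !scalerDr !bE.
by [].
Qed.

Lemma iso_params : 2%:R != 0 :> F -> 3%:R != 0 :> F ->
  exists sigma : {rmorphism F -> F}, exists2 u : F, u != 0 &
  [/\ a' = u ^+ 4 * sigma a, l' = u ^+ 2 * sigma l & m' = u ^+ 3 * sigma m].
Proof.
move=> nz2 nz3; have [sigma aZ] := scal_rmorphism.
exists sigma; have bZ := beta_semilinear aZ.
have a0 : alpha 0 = 0 by apply: (addrI (alpha 0)); rewrite -aD !addr0.
have b0 : beta 0 = 0 by apply: (addrI (beta 0)); rewrite -bD !addr0.
have sK : exists tau, cancel tau sigma.
  by have [tau _ tK] := injF_bij (fmorph_inj sigma); exists tau.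
have {sK} [tau tauK] := sK.
have surj n (v : 'cV[F]_n) : exists u, v = map_mx sigma u.
  by exists (map_mx tau v); apply/colP => i; rewrite !mxE tauK.
pose X := \matrix_(i, j) alpha (delta_mx j 0) i 0.
pose Z := \matrix_(i, j) beta (delta_mx j 0) i 0.
have XE u : alpha u = X *m map_mx sigma u := semilinear_mx aD aZ u.
have ZE u : beta u = Z *m map_mx sigma u := semilinear_mx bD bZ u.
have det_nz n (M : 'M[F]_n) (g : 'cV[F]_n -> 'cV[F]_n) : injective g ->
  g 0 = 0 ->
    (forall u, g u = M *m map_mx sigma u) -> \det M != 0.
  move=> g_inj g0 gE; rewrite -det_tr; apply/det0P => -[v nzv vM].
  have [u Eu] := surj _ v^T; case/negP: nzv.
  have : u = 0.
    apply: g_inj; rewrite g0 gE -Eu; apply: trmx_inj.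
    by rewrite trmx_mul trmxK vM trmx0.
  by move=> u0; rewrite -[v]trmxK Eu u0 map_mx0 trmx0.
have nzX := det_nz _ _ _ a_inj a0 XE; have nzZ := det_nz _ _ _ b_inj b0 ZE.
(* The components of the tensor are dual to the coordinates y of the pencil, so the pencils are
   related by the transpose of the matrix of [beta]. *)
rewrite -det_tr in nzZ.
have XZi i : X^T *m Bc a' l' m' i *m X =
    \sum_j Z i j *: Bc (sigma a) (sigma l) (sigma m) j.
  apply: mx_bilin_inj => v w; have [u ->] := surj _ v; have [u' ->] := surj _ w.
  have /(congr1 (fun w : 'cV_3 => w i 0)) := bt u u'.
  rewrite XE XE ZE tensorE trmx_mul !mulmxA => <-.
  rewrite mxE mulmx_sumr mulmx_suml summxE; apply: eq_bigr => j _.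
  rewrite -scalemxAr -scalemxAl [RHS]mxE; congr (_ * _).
  have BE : Bc (sigma a) (sigma l) (sigma m) j = map_mx sigma (Bc a l m j).
    by rewrite /Bc map_Bm map_e3.
  rewrite [LHS]mxE tensorE BE map_trmx -!map_mxM.
  by rewrite [RHS]mxE.
have XZ y : X^T *m Bm a' l' m' y *m X =
  Bm (sigma a) (sigma l) (sigma m) (Z^T *m y).
  move: y; apply: cV3_lin_ext => [c x y|c x y|i].
  - by rewrite Bm_lin congr_mx_lin.
  - by rewrite mulmxDr -scalemxAr Bm_lin.
  rewrite XZi sum3E [RHS]Bm_sum -addrA.
  have zE j : (Z^T *m e3 F i) j 0 = Z i j by rewrite -colE !mxE.
  by rewrite !zE.
exact: params_equiv nzX nzZ XZ nz2 nz3.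
Qed.

End IsoParams.

Lemma isog_params (F : finFieldType) (a l m a' l' m' : F) :
  2%:R != 0 :> F -> 3%:R != 0 :> F ->
  [set: baer (Bc a l m)] \isog [set: baer (Bc a' l' m')] ->
  exists sigma : {rmorphism F -> F}, exists2 u : F, u != 0 &
  [/\ a' = u ^+ 4 * sigma a, l' = u ^+ 2 * sigma l & m' = u ^+ 3 * sigma m].
Proof.
move=> nz2 nz3.
case/(baer_isog_pair nz2 (Bc_alt a l m) (Bc_alt a' l' m')
  (@tensor_Bc_eq0 _ a l m) (@tensor_Bc_eq0 _ a' l' m')) => alpha [beta [aD bD a_inj b_inj bt]].
exact: iso_params aD bD a_inj b_inj bt nz2 nz3.
Qed.

(** * From parameters to groups *)

Lemma pair_baer_isog (F : finFieldType) n m (B B' : 'I_m -> 'M[F]_n)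
    (alpha : 'cV[F]_n -> 'cV[F]_n) (beta : 'cV[F]_m -> 'cV[F]_m) :
  2%:R != 0 :> F ->
  {morph alpha : u v / u + v} -> {morph beta : u v / u + v} ->
  injective alpha -> injective beta ->
  (forall u v, beta (tensor B u v) = tensor B' (alpha u) (alpha v)) ->
  [set: baer B] \isog [set: baer B'].
Proof.
move=> nz2 aD bD a_inj b_inj bt.
(* Additivity suffices to commute with halving, since 2 is invertible. *)
have bH w : beta (2%:R^-1 *: w) = 2%:R^-1 *: beta w.
  apply: (scalerI nz2); rewrite scalerA mulfV // scale1r scaler_nat mulr2n -bD.
  by rewrite scale_halfD.
pose f (x : baer B) : baer B' := (alpha x.1, beta x.2).
have fM : {in [set: baer B] &, {morph f : x y / (x * y)%g}}.
  by move=> x y _ _; rewrite !baer_mulE /f /= aD !bD bH bt.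
have f_inj : injective f.
  by move=> [x x'] [y y'] [/a_inj -> /b_inj ->].
apply/isogP; exists (Morphism fM).
  by apply/injmP => x y _ _ /f_inj.
have [ai _ aiK] := injF_bij a_inj; have [bi _ biK] := injF_bij b_inj.
apply/setP => y; rewrite inE; apply/morphimP.
by exists (ai y.1, bi y.2); rewrite ?inE //= /f aiK biK -surjective_pairing.
Qed.

Lemma rmorph_baer_isog (F : finFieldType) (sigma : {rmorphism F -> F})
    (a l m : F) :
  2%:R != 0 :> F ->
  [set: baer (Bc a l m)] \isog [set: baer (Bc (sigma a) (sigma l) (sigma m))].
Proof.
move=> nz2; pose s n (v : 'cV[F]_n) := map_mx sigma v.
have s_inj n : injective (s n).
  move=> x y /matrixP xy; apply/matrixP => i j.
  by have := xy i j; rewrite !mxE => /fmorph_inj.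
apply: (@pair_baer_isog _ _ _ _ _ (s _) (s _)) => //.
- by move=> x y; rewrite /s map_mxD.
- by move=> x y; rewrite /s map_mxD.
move=> u v; apply/colP => i; rewrite /s mxE !tensorE.
have -> : Bc (sigma a) (sigma l) (sigma m) i = map_mx sigma (Bc a l m i).
  by rewrite /Bc map_Bm map_e3.
by rewrite map_trmx -!map_mxM [RHS]mxE.
Qed.

Lemma scaling_baer_isog (F : finFieldType) (u a l m : F) :
  2%:R != 0 :> F -> u != 0 ->
  [set: baer (Bc (u ^+ 4 * a) (u ^+ 2 * l) (u ^+ 3 * m))] \isog
  [set: baer (Bc a l m)].
Proof.
move=> nz2 nzu.
pose D3 x y z : 'M[F]_3 := mx3 [:: [:: x; 0; 0]; [:: 0; y; 0]; [:: 0; 0; z]].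
have detD x y z : \det (D3 x y z) = x * (y * z).
  by rewrite det3 !mx3E /=; ring.
(* Give l, m, a the weights 2, 3, 4 and y1, y2, y3 the weights 3, 4, 1. Each entry (i, j) of J is
   then homogeneous of weight r_i + c_j, with r = (1, 2, 0) and c = (2, 3, 1). *)
pose R := D3 u (u ^+ 2) 1; pose C := D3 (u ^+ 2) (u ^+ 3) u.
pose Z := D3 (u ^+ 3) (u ^+ 4) u.
have ZE y : Z *m y = \col_i nth 0 [:: u ^+ 3 * y 0 0; u ^+ 4 * y 1 0;
  u * y 2%:R 0] i.
  by apply/colP => i; rewrite mulmx3; case: (ord3P i) => ->; rewrite !mxE /=;
    ring.
have Zii (y : 'cV_3) i : (Z *m y) i 0 = Z i i * y i 0.
  by rewrite ZE; case: (ord3P i) => ->; rewrite !mxE.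
have RJC y : R *m Jm a l m y *m C =
    Jm (u ^+ 4 * a) (u ^+ 2 * l) (u ^+ 3 * m) (Z *m y).
  rewrite ZE /Jm !mxE /=; move: (y 0 0) (y 1 0) (y 2%:R 0) => y0 y1 y2.
  by rewrite /R /C /D3 !mul_mx3; apply/mx3P; rewrite !mx3E /=; ring.
pose Y : 'M[F]_(3 + 3) := block_mx R 0 0 C.
have sym x y z : (D3 x y z)^T = D3 x y z by apply/mx3P; rewrite !mxE.
have YBY i : Y *m Bc a l m i *m Y^T =
    Z i i *: Bc (u ^+ 4 * a) (u ^+ 2 * l) (u ^+ 3 * m) i.
  transitivity (Bm (u ^+ 4 * a) (u ^+ 2 * l) (u ^+ 3 * m) (Z *m e3 F i)).
    rewrite /Bc /Bm /skew_block tr_block_mx !mulmx_block !(trmx0, mul0mx,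
      mulmx0).
    rewrite !(add0r, addr0, mul0mx, mulmx0) !sym -RJC !trmx_mul !sym.
    by rewrite mulmxN mulNmx mulmxA.
  have -> : Z *m e3 F i = Z i i *: e3 F i.
    by rewrite ZE; apply/colP => j; case: (ord3P i) => ->;
      case: (ord3P j) => ->;
       rewrite !mxE /=; ring.
  have B0 : Bm (u ^+ 4 * a) (u ^+ 2 * l) (u ^+ 3 * m) 0 = 0.
    by rewrite Bm_sum !mxE !scale0r !addr0.
  by rewrite -[_ *: e3 F i]addr0 Bm_lin B0 addr0.
have mulmx_inj n (M : 'M[F]_n) : \det M != 0 ->
  injective (fun v : 'cV[F]_n => M *m v).
  move=> nzM x y /(congr1 (mulmx (invmx M))).
  by rewrite !mulKmx // unitmxE unitfE.
apply: (@pair_baer_isog _ _ _ _ _ (mulmx Y^T) (mulmx Z)) => //.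
- by move=> x y; rewrite mulmxDr.
- by move=> x y; rewrite mulmxDr.
- apply: mulmx_inj; rewrite det_tr det_ublock !detD.
  by rewrite !mulf_neq0 ?expf_neq0 ?oner_eq0.
- by apply: mulmx_inj; rewrite detD !mulf_neq0 ?expf_neq0.
move=> v w; apply/colP => i; rewrite [RHS]tensorE trmx_mul trmxK.
have -> : v^T *m Y *m Bc a l m i *m (Y^T *m w) =
  v^T *m (Y *m Bc a l m i *m Y^T) *m w.
  by rewrite !mulmxA.
by rewrite YBY -scalemxAr -scalemxAl [RHS]mxE Zii tensorE.
Qed.

Lemma params_isog (F : finFieldType) (sigma : {rmorphism F -> F})
    (u a l m a' l' m' : F) : 2%:R != 0 :> F -> u != 0 ->
  a' = u ^+ 4 * sigma a -> l' = u ^+ 2 * sigma l -> m' = u ^+ 3 * sigma m ->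
  [set: baer (Bc a l m)] \isog [set: baer (Bc a' l' m')].
Proof.
move=> nz2 nzu -> -> ->; apply: isog_trans (rmorph_baer_isog sigma a l m nz2) _.
by rewrite isog_sym; apply: scaling_baer_isog.
Qed.

(** Scaling by an element of F_p is multiplication by a natural number, which every ring morphism
    fixes; so sigma is linear over F_p. *)
Lemma rmorphism_gal (F : finFieldType) (p : nat) (charFp : p \in [pchar F])
    (sigma : {rmorphism F -> F}) :
  exists2 s : gal_of {: pPrimeCharType charFp}, s \in GalFp charFp &
    gal_map s =1 sigma.
Proof.
pose L := pPrimeCharType charFp; pose tau : L -> L := sigma.
have tauP : linear tau.
  move=> c x y; rewrite /tau [LHS](rmorphD sigma).
  by congr (_ + _); apply: etrans (rmorphM sigma _ _) _; rewrite rmorph_nat.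
pose tauL := GRing.isLinear.Build 'F_p L L *:%R tau tauP.
pose t : {linear L -> L} := HB.pack_for {linear L -> L} tau tauL.
have homt : kAut 1 {: L} (linfun t).
  rewrite kAutE subvf andbT; apply/andP; split.
    apply/ahom_inP; split=> [x y _ _|]; rewrite !lfunE /=.
      exact: (rmorphM sigma).
    exact: (rmorph1 sigma).
  apply/subvP => x /vlineP[c ->]; apply/fixedSpaceP.
  rewrite lfunE /=; apply: etrans (rmorphM sigma _ _) _.
  by rewrite rmorph_nat rmorph1.
have [s galS sE] := kAut_to_gal homt.
exists s => // x; have := sE (x : L) (memvf _).
rewrite lfunE => e; exact: esym e.
Qed.

Lemma B_coef_Bc (F : finFieldType) (E : weierstrass F) (P : P2 F) i :
  B_coef E P i = Bc (wa E) (lambda P) (mu P) i :> 'M[F]_(3 + 3).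
Proof.
rewrite /Bc /Bm /skew_block.
transitivity (map_mx (mcoeff U_(i)) (block_mx 0 (J_EP E P) (- (J_EP E P)^T) 0 :
  'M_(3 + 3))).
  by [].
rewrite map_block_mx !map_mx0 map_mxN -map_trmx.
suff -> : map_mx (mcoeff U_(i)) (J_EP E P) =
  Jm (wa E) (lambda P) (mu P) (e3 F i) by [].
have UE (j k : 'I_3) : (U_(j)%MM == U_(k)%MM) = (j == k).
  apply/eqP/eqP => [/mnmP/(_ j)|-> //]; rewrite !mnm1E eqxx eq_sym.
  by case: eqP.
case: (ord3P i) => ->; apply/mx3P; rewrite !mxE /=
  ?(mcoeffB, mcoeffD, mcoeffN, mcoeffZ, mcoeff0, mcoeffX) ?UE //=.
Qed.

(** * Points of the projective plane *)

Section Points.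
Variable k : fieldType.
Implicit Types (v w : 'rV[k]_3) (Q : P2 k) (x y : k).

Lemma row3P v w : v 0 0 = w 0 0 -> v 0 1 = w 0 1 -> v 0 2%:R = w 0 2%:R ->
  v = w.
Proof. by move=> *; apply/rowP => i; case: (ord3P i) => ->. Qed.

Lemma row3E (a b c : k) :
  (row3 a b c 0 0 = a) * (row3 a b c 0 1 = b) * (row3 a b c 0 2%:R = c).
Proof. by rewrite !mxE. Qed.

Lemma line_hc Q : line Q = <[hc Q]>%VS.
Proof.
apply/eqP; rewrite eq_sym eqEdim -memvE memv_pick (eqP (dim_line Q)).
by rewrite dim_vline hc_neq0.
Qed.

Lemma hc_mkpt v (nz : v != 0) : exists2 c, c != 0 & hc (mkpt nz) = c *: v.
Proof.
have /vlineP[c hcE] : hc (mkpt nz) \in <[v]>%VS by apply: memv_pick.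
exists c => //; apply: contraNneq (hc_neq0 (mkpt nz)) => c0.
by rewrite hcE c0 scale0r.
Qed.

Lemma vline_scale (c : k) v : c != 0 -> <[c *: v]>%VS = <[v]>%VS.
Proof.
move=> nzc; apply/eqP; rewrite eqEsubv; apply/andP; split; apply/vlineP.
  by exists c.
by exists c^-1; rewrite scalerA mulVf // scale1r.
Qed.

Lemma P2_eq Q Q' v c : line Q = <[v]>%VS -> c != 0 -> hc Q' = c *: v -> Q = Q'.
Proof.
move=> EQ nzc EQ'; apply: val_inj => /=.
by rewrite EQ line_hc EQ' vline_scale.
Qed.

Lemma row3_1_neq0 x y : row3 x y 1 != 0 :> 'rV[k]_3.
Proof. by apply/eqP => /rowP/(_ 2%:R)/eqP; rewrite row3E mxE oner_eq0. Qed.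

Definition affpt x y : P2 k := mkpt (row3_1_neq0 x y).

Definition xc Q := hc Q 0 0 / hc Q 0 2%:R.
Definition yc Q := hc Q 0 1 / hc Q 0 2%:R.

Lemma affptE Q : hc Q 0 2%:R != 0 -> Q = affpt (xc Q) (yc Q).
Proof.
move=> nz; symmetry; apply: (P2_eq (v := row3 (xc Q) (yc Q) 1) _ nz) => //.
by apply: row3P; rewrite mxE row3E ?mulr1 // mulrC divfK.
Qed.

Lemma affpt_hc x y : exists2 c, c != 0 & hc (affpt x y) = c *: row3 x y 1.
Proof. exact: hc_mkpt. Qed.

Lemma affpt_z x y : hc (affpt x y) 0 2%:R != 0.
Proof. by have [c nzc ->] := affpt_hc x y; rewrite mxE row3E mulr1. Qed.

Lemma xc_affpt x y : xc (affpt x y) = x.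
Proof.
rewrite /xc; have [c nzc ->] := affpt_hc x y.
by rewrite !mxE /= mulr1 mulrC mulKf.
Qed.

Lemma yc_affpt x y : yc (affpt x y) = y.
Proof.
rewrite /yc; have [c nzc ->] := affpt_hc x y.
by rewrite !mxE /= mulr1 mulrC mulKf.
Qed.

Lemma Opt_z : hc (Opt k) 0 2%:R = 0.
Proof. by have [c _ ->] := hc_mkpt (row010_neq0 k);
  rewrite mxE row3E mulr0. Qed.

Lemma affpt_neqO x y : affpt x y != Opt k.
Proof. by apply: contraNneq (affpt_z x y) => ->; rewrite Opt_z. Qed.

Definition wpoly (a b : k) : {mpoly k[3]} :=
  'X_1 ^+ 2 * 'X_(2%:R) - ('X_0 ^+ 3 + a *: ('X_0 * 'X_(2%:R) ^+ 2)
    + b *: 'X_(2%:R) ^+ 3).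

Lemma wpoly_eval a b (v : 'I_3 -> k) : (wpoly a b).@[v] =
  v 1 ^+ 2 * v 2%:R - (v 0 ^+ 3 + a * (v 0 * v 2%:R ^+ 2) + b * v 2%:R ^+ 3).
Proof.
by rewrite !(mevalB, mevalD, mevalM, mevalZ, rmorphXn) /= !mevalXU.
Qed.

Lemma affpt_curve a b x y :
  (affpt x y \in curve (wpoly a b)) = (y ^+ 2 == x ^+ 3 + a * x + b).
Proof.
rewrite inE /= wpoly_eval; have [c nzc ->] := affpt_hc x y; rewrite !mxE /=.
rewrite -[RHS]subr_eq0 -[RHS]orFb -(negPf (expf_neq0 3 nzc)) -mulf_eq0.
by congr (_ == _); ring.
Qed.

Lemma Opt_curve a b : Opt k \in curve (wpoly a b).
Proof.
rewrite inE /= wpoly_eval; have [c _ ->] := hc_mkpt (row010_neq0 k).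
by rewrite !mxE /=; apply/eqP; ring.
Qed.

Lemma curve_z0 a b Q : Q \in curve (wpoly a b) -> hc Q 0 2%:R = 0 -> Q = Opt k.
Proof.
rewrite inE /= wpoly_eval => + z0; rewrite z0.
rewrite !(expr0n, mulr0, addr0, sub0r) /= oppr_eq0 expf_eq0 /= => /eqP x0.
have nzy : hc Q 0 1 != 0.
  by apply: contraNneq (hc_neq0 Q) => y0; apply/eqP/row3P;
    rewrite ?x0 ?y0 ?z0 mxE.
symmetry; apply: (P2_eq (v := row3 0 1 0) _ nzy) => //.
by apply: row3P; rewrite mxE row3E ?mulr0 ?mulr1.
Qed.

Lemma curve_affpt a b Q : Q \in curve (wpoly a b) -> Q != Opt k ->
  Q = affpt (xc Q) (yc Q) /\ yc Q ^+ 2 = xc Q ^+ 3 + a * xc Q + b.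
Proof.
move=> CQ; have [z0|nz _] := eqVneq (hc Q 0 2%:R) 0.
  by rewrite (curve_z0 CQ z0) eqxx.
have E := affptE nz; split=> //; apply/eqP; rewrite -affpt_curve.
by rewrite -E.
Qed.

End Points.

Lemma weq_wpoly (F : fieldType) (E : weierstrass F) : weq E =
  wpoly (wa E) (wb E).
Proof. by []. Qed.

Section Mapping.
Variables (F K : fieldType) (f : {rmorphism F -> K}).

Lemma map_wpoly a b : map_mpoly f (wpoly a b) = wpoly (f a) (f b).
Proof.
rewrite /wpoly !(rmorphB, rmorphD, rmorphM, rmorphXn, map_mpolyZ) /=.
by rewrite !map_mpolyX !map_mpolyZ !rmorphM /= !map_mpolyX.
Qed.

Lemma map_affpt x y : map_pt f (affpt x y) = affpt (f x) (f y).
Proof.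
have [c nzc hcE] := affpt_hc x y.
symmetry; have [d nzd dE] := hc_mkpt (map_hc_neq0 f (affpt x y)).
apply: (P2_eq (v := row3 (f x) (f y) 1) (c := d * f c)) => //.
  by rewrite mulf_neq0 ?fmorph_eq0.
rewrite dE hcE -scalerA; congr (_ *: _).
by apply: row3P; rewrite !(mxE, row3E) /= !rmorphM ?rmorph1.
Qed.

Lemma map_mpoly_eval (h : {mpoly F[3]}) (v : 'I_3 -> K) : (map_mpoly f h).@[v] =
  \sum_(m <- msupp h) f h@_m * \prod_i v i ^+ m i.
Proof.
rewrite /map_mpoly /mmap raddf_sum /=; apply: eq_bigr => m _.
rewrite mevalM mevalC /mmap1 rmorph_prod /=; congr (_ * _).
by apply: eq_bigr => i _; rewrite rmorphXn /= mevalXU.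
Qed.

Lemma dhomog_eval d (h : {mpoly F[3]}) (v : 'I_3 -> K) c : h \is d.-homog ->
  (map_mpoly f h).@[fun i => c * v i] = c ^+ d * (map_mpoly f h).@[v].
Proof.
move/dhomogP => hd; rewrite !map_mpoly_eval big_distrr /= !big_seq.
apply: eq_bigr => m /hd <-; rewrite mulrCA; congr (_ * _).
rewrite /= mdegE -prodrXr -big_split /=; apply: eq_bigr => i _.
by rewrite exprMn.
Qed.

End Mapping.

(** * Functions on an affine cubic *)

Section ClosedField.
Variable K : closedFieldType.
Implicit Types (p q : {poly K}) (x y c : K).

Lemma closed_sqrt c : exists y, y ^+ 2 = c.
Proof.
have /closed_rootP[y] : size ('X^2 - c%:P : {poly K}) != 1%N.
  by rewrite size_XnsubC.
by rewrite /root !hornerE subr_eq0 => /eqP; exists y.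
Qed.

Lemma closed_poly0 p : (forall x, p.[x] = 0) -> p = 0.
Proof.
move=> p0; apply/eqP; apply: contraT => nzp.
have [s1|s1] := eqVneq (size p) 1%N.
  have [c nzc pE] := size_poly1P _ (introT eqP s1).
  by have := p0 0; rewrite pE hornerC => /eqP; rewrite (negPf nzc).
(* [p + 1] takes only the value 1, so a root of it is absurd. *)
have /closed_rootP[x] : size (p + 1) != 1%N.
  rewrite size_polyDl // size_poly1.
  by move: (size p) s1 nzp (size_poly_eq0 p) => [|[|n]] // _ /negPf ->.
by rewrite /root hornerD p0 hornerC add0r oner_eq0.
Qed.

Lemma size_mulf p q : p != 0 -> q != 0 -> size (p * q) = (size p + size q).-1.
Proof. exact: size_mul. Qed.

End ClosedField.

(* Locked, lest [hornerD] and the like see through it. *)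
Definition wcub (k : fieldType) (a b : k) : {poly k} :=
  locked ('X^3 + a *: 'X + b%:P).

Section FunctionRing.
Variable K : closedFieldType.
Variables a b : K.
Implicit Types (p q r s : {poly K}) (x y c : K) (g h : K -> K -> K).

Local Notation w := (wcub a b).

Lemma wcub_eval x : w.[x] = x ^+ 3 + a * x + b.
Proof. by rewrite /wcub -lock !hornerE. Qed.

Lemma size_wcub : size w = 4%N.
Proof.
rewrite /wcub -lock -addrA size_polyDl size_polyXn //.
rewrite (leq_ltn_trans (size_polyD _ _)) // gtn_max.
rewrite (leq_ltn_trans (size_scale_leq _ _)) ?size_polyX //.
by rewrite (leq_ltn_trans (size_polyC_leq1 _)).
Qed.

Lemma wcub_neq0 : w != 0.
Proof. by rewrite -size_poly_eq0 size_wcub. Qed.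

(** The coordinate ring of the affine curve is free over K[x] with basis 1, y. A regular function is
    a map on K x K considered only at points of the curve. *)
Definition rep p q g :=
  forall x y, y ^+ 2 = w.[x] -> g x y = p.[x] + y * q.[x].

Definition norm_poly p q := p ^+ 2 - q ^+ 2 * w.

(** The degree of p^2 is even and that of q^2 w is odd, so leading terms never cancel. The truncated
    predecessor gives 0 for p = 0. *)
Lemma size_norm_poly p q : size (norm_poly p q) =
  maxn (size p).*2.-1 (if q == 0%R then 0 else (size q).*2 + 2)%N.
Proof.
have sp : size (p ^+ 2) = (size p).*2.-1.
  have [->|nzp] := eqVneq p 0; first by rewrite expr0n size_poly0.
  by rewrite expr2 size_mulf // addnn.
have sq : size (q ^+ 2 * w) = if q == 0 then 0%N else (size q).*2.+2.
  have [->|nzq] := eqVneq q 0; first by rewrite expr0n mul0r size_poly0.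
  rewrite size_mulf ?expf_neq0 ?wcub_neq0 // expr2 size_mulf // size_wcub.
  have : (0 < size q)%N by rewrite size_poly_gt0.
  by lia.
rewrite /norm_poly; have [lt|] := ltnP (size (q ^+ 2 * w)) (size (p ^+ 2)).
  rewrite size_polyDl ?size_polyN // sp; move: lt; rewrite sp sq.
  by case: eqP => _; lia.
rewrite leq_eqVlt => /orP[/eqP e|lt].
  have p0 : p = 0.
    apply/eqP; rewrite -size_poly_eq0; move: e; rewrite sp sq.
    by case: eqP; lia.
  move: e; rewrite p0 expr0n size_poly0 sq => /esym.
  by case: eqP => [->|_] //= _; rewrite expr0n mul0r subrr size_poly0.
rewrite addrC size_polyDl ?size_polyN // sq; move: lt; rewrite sp sq.
by case: eqP => _; lia.
Qed.

Lemma norm_poly_eq0 p q : norm_poly p q = 0 -> p = 0 /\ q = 0.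
Proof.
move=> n0; have := size_norm_poly p q; rewrite n0 size_poly0.
case: eqP => [->|_] e; last by lia.
by split=> //; apply/eqP; rewrite -size_poly_eq0; lia.
Qed.

Lemma norm_poly_eval p q x y : y ^+ 2 = w.[x] ->
  (norm_poly p q).[x] = (p.[x] + y * q.[x]) * (p.[x] - y * q.[x]).
Proof.
by move=> C; rewrite /norm_poly !expr2 !(hornerD, hornerN, hornerM) -C; ring.
Qed.

Lemma rep0 p q g : rep p q g -> (forall x y, y ^+ 2 = w.[x] -> g x y = 0) ->
  p = 0 /\ q = 0.
Proof.
move=> rg g0; apply: norm_poly_eq0; apply: closed_poly0 => x.
have [y C] := closed_sqrt w.[x].
by rewrite (norm_poly_eval _ _ C) -rg // g0 // mul0r.
Qed.

Lemma repB p q p' q' g h : rep p q g -> rep p' q' h ->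
  rep (p - p') (q - q') (fun x y => g x y - h x y).
Proof. by move=> rg rh x y C; rewrite rg // rh // !(hornerD, hornerN);
  ring. Qed.

Lemma repD p q p' q' g h : rep p q g -> rep p' q' h ->
  rep (p + p') (q + q') (fun x y => g x y + h x y).
Proof. by move=> rg rh x y C; rewrite rg // rh // !(hornerD, hornerN);
  ring. Qed.

Lemma repM p q p' q' g h : rep p q g -> rep p' q' h ->
  rep (p * p' + q * q' * w) (p * q' + q * p') (fun x y => g x y * h x y).
Proof.
move=> rg rh x y C; rewrite rg // rh // !(hornerD, hornerM) -C.
by ring.
Qed.

Lemma repC c : rep c%:P 0 (fun _ _ => c).
Proof. by move=> x y C; rewrite !hornerE. Qed.

Lemma repP p : rep p 0 (fun x _ => p.[x]).
Proof. by move=> x y C; rewrite !hornerE. Qed.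

Lemma repY : rep 0 1 (fun _ y => y).
Proof. by move=> x y C; rewrite !hornerE. Qed.

Lemma rep_eq p q g h : (forall x y, y ^+ 2 = w.[x] -> h x y = g x y) ->
  rep p q g -> rep p q h.
Proof. by move=> gh rg x y C; rewrite gh ?rg. Qed.

Lemma rep_uniq p q p' q' g : rep p q g -> rep p' q' g -> p = p' /\ q = q'.
Proof.
move=> rg rg'; have [] := rep0 (repB rg rg') _; first by move=> *;
  rewrite subrr.
by move=> /eqP; rewrite subr_eq0 => /eqP -> /eqP; rewrite subr_eq0 => /eqP ->.
Qed.

(* The order of the pole at infinity is the degree of the norm. *)
Definition pole_order g n := exists p q,
  rep p q g /\ size (norm_poly p q) = n.+1.

Lemma pole_order_eq g h n : (forall x y, y ^+ 2 = w.[x] -> h x y = g x y) ->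
  pole_order g n -> pole_order h n.
Proof. by move=> gh [p [q [rg s]]]; exists p, q; split=> //;
  apply: rep_eq rg. Qed.

Lemma pole_order_uniq g n m : pole_order g n -> pole_order g m -> n = m.
Proof.
move=> [p [q [rg s]]] [p' [q' [rg' s']]].
by have [pE qE] := rep_uniq rg rg'; apply/succn_inj; rewrite -s -s' pE qE.
Qed.

Lemma pole_orderM g h n m : pole_order g n -> pole_order h m ->
  pole_order (fun x y => g x y * h x y) (n + m)%N.
Proof.
move=> [p [q [rg s]]] [p' [q' [rg' s']]]; do 2!eexists; split;
  first exact: repM rg rg'.
have -> : norm_poly (p * p' + q * q' * w) (p * q' + q * p') =
  norm_poly p q * norm_poly p' q'.
  by rewrite /norm_poly; ring.
rewrite size_mulf -?size_poly_eq0 ?s ?s' //; lia.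
Qed.

Lemma pole_orderD g h n m : (m < n)%N -> pole_order g n -> pole_order h m ->
  pole_order (fun x y => g x y + h x y) n.
Proof.
move=> lt [p [q [rg s]]] [p' [q' [rg' s']]]; do 2!eexists; split;
  first exact: repD rg rg'.
move: s s'; rewrite !size_norm_poly => s s'.
have [le|] := leqP n.+1 (if q == 0%R then 0 else (size q).*2 + 2)%N.
  have nzq : q != 0 by move: le; case: eqP.
  have sq' : (size q' < size q)%N.
    move: le s s'; rewrite (negPf nzq); case: (eqVneq q' 0) => [->|_]; last lia.
    by rewrite size_poly0 size_poly_gt0.
  have -> : size (q + q') = size q by rewrite size_polyDl.
  have -> : (q + q' == 0) = false.
    by apply/negbTE; rewrite -size_poly_eq0 size_polyDl // size_poly_eq0.
  have := size_polyD p p'; move: le s s'; rewrite (negPf nzq).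
  by case: (eqVneq q' 0) => _; lia.
move=> le; have sp' : (size p' < size p)%N.
  by move: le s s'; case: (eqVneq q 0) => _; case: (eqVneq q' 0) => _; lia.
have -> : size (p + p') = size p by rewrite size_polyDl.
have := size_polyD q q'; have := size_poly_gt0 (q + q').
move: le s s'; case: (eqVneq q 0) => [->|_]; case: (eqVneq q' 0) => [->|_];
  by case: (eqVneq (_ + _) 0) => _; rewrite ?size_poly0 /= => *; lia.
Qed.

Lemma pole_orderC c : c != 0 -> pole_order (fun _ _ => c) 0.
Proof.
move=> nzc; exists c%:P, 0; split; first exact: repC.
by rewrite size_norm_poly eqxx size_polyC nzc.
Qed.

Lemma pole_orderX : pole_order (fun x _ => x) 2.
Proof.
exists 'X, 0; split; first by apply: rep_eq (repP 'X) => x y _; rewrite hornerX.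
by rewrite size_norm_poly eqxx size_polyX.
Qed.

Lemma pole_orderY : pole_order (fun _ y => y) 3.
Proof.
exists 0, 1; split; first exact: repY.
by rewrite size_norm_poly oner_eq0 size_poly0 size_poly1.
Qed.

Lemma pole_order0_const p q g : rep p q g -> (size (norm_poly p q) <= 1)%N ->
  exists c, forall x y, y ^+ 2 = w.[x] -> g x y = c.
Proof.
move=> rg; rewrite size_norm_poly; case: eqP => [q0|_] s; last by lia.
exists p`_0 => x y C; rewrite rg // q0 horner0 mulr0 addr0.
by rewrite [p in p.[x]]size1_polyC ?hornerC //; lia.
Qed.

Lemma pole_order_or_zero p q g : rep p q g ->
  (exists n, pole_order g n) \/ (p = 0 /\ q = 0).
Proof.
move=> rg; case s : (size (norm_poly p q)) => [|n].
  by right; apply: norm_poly_eq0; apply/eqP; rewrite -size_poly_eq0 s.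
by left; exists n, p, q.
Qed.

Lemma pole_order_poly g n p : pole_order g n -> (0 < n)%N -> p != 0 ->
  pole_order (fun x y => p.[g x y]) (n * (size p).-1)%N.
Proof.
move=> dg n0; elim/poly_ind: p => [|p c IH]; first by rewrite eqxx.
move=> nz; have [p0|nzp] := eqVneq p 0.
  move: nz; rewrite p0 mul0r add0r size_polyC polyC_eq0 => nzc.
  rewrite nzc muln0.
  by apply: pole_order_eq (pole_orderC nzc) => x y _; rewrite hornerC.
rewrite -cons_poly_def size_cons_poly nil_poly (negPf nzp) /=.
have sp : size p = (size p).-1.+1 by rewrite prednK // size_poly_gt0.
rewrite [X in (n * X)%N]sp mulnSr.
have [-> |nzc] := eqVneq c 0.
  by apply: pole_order_eq (pole_orderM (IH nzp) dg) => x y _;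
    rewrite cons_poly_def !hornerE.
apply: pole_order_eq (pole_orderD _ (pole_orderM (IH nzp) dg) (pole_orderC
  nzc)); last by lia.
by move=> x y _; rewrite cons_poly_def !hornerE.
Qed.

End FunctionRing.

(** * Invertible polynomial maps between affine cubics *)

Section CurveMaps.
Variable K : closedFieldType.
Hypotheses (nz2 : 2%:R != 0 :> K) (nz3 : 3%:R != 0 :> K).
Variables a b c d : K.
Variables X Y : K -> K -> K.
Variables p1 q1 p2 q2 r1 s1 r2 s2 : {poly K}.
Hypotheses (repX : rep a b p1 q1 X) (repY : rep a b p2 q2 Y).
Hypothesis XY : forall x y, y ^+ 2 = (wcub a b).[x] ->
  Y x y ^+ 2 = (wcub c d).[X x y].
Hypothesis xE : forall x y, y ^+ 2 = (wcub a b).[x] ->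
  x = r1.[X x y] + Y x y * s1.[X x y].
Hypothesis yE : forall x y, y ^+ 2 = (wcub a b).[x] ->
  y = r2.[X x y] + Y x y * s2.[X x y].
Hypothesis Xnc : forall e, ~ (forall x y, y ^+ 2 = (wcub a b).[x] -> X x y = e).

(** The orders of p(X) and Y q(X) are j times an even and j times an odd number. They are therefore
    distinct, and the order of the sum is the larger of the two. *)
Lemma pole_order_multiple j p q g n : (0 < j)%N -> pole_order a b X j.*2 ->
  pole_order a b Y (3 * j)%N ->
  (forall x y, y ^+ 2 = (wcub a b).[x] ->
    g x y = p.[X x y] + Y x y * q.[X x y]) ->
  pole_order a b g n -> (j %| n)%N.
Proof.
move=> j0 dX dY gE dg; have j20 : (0 < j.*2)%N by rewrite double_gt0.
have [q0|nzq] := eqVneq q 0.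
  have [p0|nzp] := eqVneq p 0.
    have [p' [q' [rg s]]] := dg.
    have [] := rep0 rg _; first by move=> x y C;
      rewrite gE // p0 q0 !horner0 mulr0 addr0.
    by move=> p'0 q'0; move: s; rewrite p'0 q'0 /norm_poly !expr0n mul0r subr0
      size_poly0.
  have dP := pole_order_poly dX j20 nzp.
  rewrite (pole_order_uniq dg (pole_order_eq _ dP)); last first.
    by move=> x y C; rewrite gE // q0 horner0 mulr0 addr0.
  by rewrite dvdn_mulr // -mul2n dvdn_mull.
have dYQ := pole_orderM dY (pole_order_poly dX j20 nzq).
have jQ : (j %| 3 * j + j.*2 * (size q).-1)%N.
  by apply: dvdn_add; [exact: dvdn_mull|rewrite dvdn_mulr // -mul2n dvdn_mull].
have [p0|nzp] := eqVneq p 0.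
  rewrite (pole_order_uniq dg (pole_order_eq _ dYQ)) //.
  by move=> x y C; rewrite gE // p0 horner0 add0r.
have dP := pole_order_poly dX j20 nzp.
have [lt|] := ltnP (j.*2 * (size p).-1)%N (3 * j + j.*2 * (size q).-1)%N.
  rewrite (pole_order_uniq dg (pole_order_eq _ (pole_orderD lt dYQ dP))) //.
  by move=> x y C; rewrite gE // addrC.
rewrite leq_eqVlt => /orP[/eqP e|lt].
  have : (3 + 2 * (size q).-1 = 2 * (size p).-1)%N.
    by apply/eqP; rewrite -(eqn_pmul2l j0); apply/eqP; rewrite -!mul2n in e *;
      lia.
  by lia.
rewrite (pole_order_uniq dg (pole_order_eq _ (pole_orderD lt dP dYQ)));
  last first.
  by move=> x y C; rewrite gE.
by rewrite dvdn_mulr // -mul2n dvdn_mull.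
Qed.

Lemma curve_map_pole_order : pole_order a b X 2 /\ pole_order a b Y 3.
Proof.
have [n dX] : exists n, pole_order a b X n.
  have [//|[p0 q0]] := pole_order_or_zero repX.
  by case: (Xnc (e := 0)) => x y C; rewrite repX // p0 q0 !horner0 mulr0 addr0.
have n0 : (0 < n)%N.
  case: n dX => // -[p [q [rg s]]].
  by have [|e /Xnc[]] := pole_order0_const rg; rewrite s.
have dw : pole_order a b (fun x y => Y x y ^+ 2) (n * 3)%N.
  have sw := size_wcub c d.
  have := pole_order_poly dX n0 (wcub_neq0 c d); rewrite sw => dw.
  by apply: pole_order_eq dw => x y C; rewrite XY.
have [k dY] : exists k, pole_order a b Y k.
  have [//|[p0 q0]] := pole_order_or_zero repY.
  have [p [q [rg s]]] := dw; have [] := rep0 rg _.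
    by move=> x y C; rewrite repY // p0 q0 !horner0 mulr0 addr0 expr0n.
  by move=> p'0 q'0; move: s; rewrite p'0 q'0 /norm_poly !expr0n mul0r subr0
    size_poly0.
(* The equation of the target curve gives 2 k = 3 n, so n = 2 j and k = 3 j. *)
have e := pole_order_uniq (pole_orderM dY dY) dw.
pose j := n./2.
have nj : n = j.*2 by rewrite /j; lia.
have kj : k = (3 * j)%N by rewrite /j; lia.
have j0 : (0 < j)%N by lia.
rewrite nj in dX; rewrite kj in dY.
have j2 := pole_order_multiple j0 dX dY xE (pole_orderX a b).
have j3 := pole_order_multiple j0 dX dY yE (pole_orderY a b).
have j1 : j = 1%N.
  by apply/eqP; rewrite -dvdn1 (_ : 1%N = gcdn 2 3) // dvdn_gcd j2.
by rewrite j1 in dX dY.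
Qed.

(* [xE] and [yE] make every function a polynomial in [X] and [Y], which have
   poles of orders [2 * j] and [3 * j]; hence [j] divides both 2 and 3. *)
Lemma curve_map_linear : exists al ga : K,
  [/\ al != 0 /\ ga != 0,
      forall x y, y ^+ 2 = (wcub a b).[x] -> X x y = al * x /\ Y x y = ga * y,
      ga ^+ 2 = al ^+ 3, c * al = ga ^+ 2 * a & d = ga ^+ 2 * b].
Proof.
have [[p [q [rX sX]]] [r [s [rY sY]]]] := curve_map_pole_order.
(* The norm has size 3, whereas a nonzero q would contribute at least 4. *)
have q0 : q = 0.
  apply/eqP; apply: contraT => nzq; move: sX;
    rewrite size_norm_poly (negPf nzq).
  have : (0 < size q)%N by rewrite size_poly_gt0.
  by lia.
have sp : size p = 2%N.
  by move: sX; rewrite size_norm_poly q0 eqxx; lia.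
have nzs : s != 0.
  by apply/eqP => s0; move: sY; rewrite size_norm_poly s0 eqxx; lia.
have ss : size s = 1%N.
  have : (0 < size s)%N by rewrite size_poly_gt0.
  by move: sY; rewrite size_norm_poly (negPf nzs); lia.
have sr : (size r <= 2)%N.
  by move: sY; rewrite size_norm_poly (negPf nzs) ss; lia.
pose al := p`_1; pose be := p`_0; pose ga := s`_0.
have nza : al != 0 by have := lead_coef_eq0 p;
  rewrite lead_coefE sp -size_poly_eq0 sp => ->.
have sE : s = ga%:P by apply: size1_polyC; rewrite ss.
have nzg : ga != 0 by apply: contraNneq nzs => g0; rewrite sE g0.
have pE x : p.[x] = be + al * x.
  by rewrite horner_coef sp !big_ord_recr big_ord0 /= add0r mulr1 expr1.
have XE x y : y ^+ 2 = (wcub a b).[x] -> X x y = be + al * x.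
  by move=> C; rewrite rX // q0 horner0 mulr0 addr0 pE.
(* Y^2 is a polynomial in x alone, whereas the y-component of (r + y s)^2 is 2 r s; this forces r =
   0. *)
pose W := (wcub c d) \Po p.
have rYY : rep a b W 0 (fun x y => Y x y ^+ 2).
  by move=> x y C; rewrite XY // (XE _ _ C) horner_comp pE horner0 mulr0 addr0.
have rYY' := repM rY rY.
have [_ e2] := rep_uniq rYY (rep_eq (fun x y _ => expr2 (Y x y)) rYY').
have r0 : r = 0.
  apply/eqP; move/esym/eqP: e2; rewrite (mulrC s) -mulr2n -scaler_nat
    scaler_eq0.
  by rewrite (negPf nz2) mulf_eq0 (negPf nzs) orbF.
have YE x y : y ^+ 2 = (wcub a b).[x] -> Y x y = ga * y.
  by move=> C; rewrite rY // r0 horner0 add0r sE hornerC mulrC.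
have key x : ga ^+ 2 * (x ^+ 3 + a * x + b) =
   (be + al * x) ^+ 3 + c * (be + al * x) + d.
  have [y C] := closed_sqrt (wcub a b).[x].
  by rewrite -wcub_eval -C -exprMn -(YE _ _ C) XY // wcub_eval (XE _ _ C).
(* The difference of the two sides of [key]. Neither cubic has a term in x^2, so the coefficient of
   x^2 forces be = 0; the others give the relations between al, ga and the parameters. *)
pose D := Poly [:: ga ^+ 2 * b - be ^+ 3 - c * be - d;
  ga ^+ 2 * a - 3%:R * be ^+ 2 * al - c * al; - 3%:R * be * al ^+ 2;
  ga ^+ 2 - al ^+ 3].
have D0 : D = 0.
  apply: closed_poly0 => x; rewrite /D horner_Poly /=.
  rewrite -[RHS](subrr ((be + al * x) ^+ 3 + c * (be + al * x) + d)).
  by rewrite -{1}(key x); ring.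
have coefD i := coef_Poly [:: ga ^+ 2 * b - be ^+ 3 - c * be - d;
  ga ^+ 2 * a - 3%:R * be ^+ 2 * al - c * al; - 3%:R * be * al ^+ 2;
  ga ^+ 2 - al ^+ 3] i.
rewrite -/D D0 in coefD.
have be0 : be = 0.
  have /esym/eqP := coefD 2%N; rewrite coef0 /= !mulNr oppr_eq0 !mulf_eq0.
  by rewrite (negPf nz3) (negPf nza) !orbF => /eqP.
have := coefD 3%N; have := coefD 1%N; have := coefD 0%N.
rewrite !coef0 /= be0 => k0 k1 k3; exists al, ga; split=> //.
- by move=> x y C; rewrite XE // YE // be0 add0r.
- by apply/eqP; rewrite -subr_eq0 -k3.
- by apply/esym/eqP; rewrite -subr_eq0; apply/eqP; rewrite [RHS]k1; ring.
- by apply/esym/eqP; rewrite -subr_eq0; apply/eqP; rewrite [RHS]k0; ring.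
Qed.

End CurveMaps.

Section RegularFunctions.
Variable K : closedFieldType.
Variables a b : K.

(* The ideal of the polynomials [n] such that [n * g] is polynomial has no zero:
   the norm of a local denominator belongs to it. *)
Lemma regular_is_polynomial g :
  (forall x0 y0, y0 ^+ 2 = (wcub a b).[x0] -> exists p q p' q' : {poly K},
     p.[x0] + y0 * q.[x0] != 0 /\
     rep a b p' q' (fun x y => (p.[x] + y * q.[x]) * g x y)) ->
  exists p q, rep a b p q g.
Proof.
move=> gloc; pose I n := exists p q, rep a b p q (fun x y => n.[x] * g x y).
pose Dn p q := exists p' q', rep a b p' q' (fun x y =>
  (p.[x] + y * q.[x]) * g x y).
have DnD p q p' q' : Dn p q -> Dn p' q' -> Dn (p + p') (q + q').
  move=> [u [v r]] [u' [v' r']]; exists (u + u'), (v + v').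
  apply: rep_eq (repD r r') => x y C; rewrite !hornerD; ring.
have Dn_I p q : Dn p q -> I (norm_poly a b p q).
  move=> [u [v r]]; do 2!eexists.
  have rc : rep a b p (- q) (fun x y => p.[x] - y * q.[x]).
    by move=> x y C; rewrite hornerN mulrN.
  apply: (rep_eq _ (repM rc r)) => x y C; rewrite (norm_poly_eval _ _ C); ring.
have I_lin n n' u v : I n -> I n' -> I (u * n + v * n').
  move=> [p [q r]] [p' [q' r']].
  have R := repD (repM (repP (b := b) u) r) (repM (repP v) r').
  do 2!eexists; apply: rep_eq R => x y C.
  by rewrite hornerD !hornerM; ring.
(* The norm of a denominator is the product of its values at (x0, y0) and (x0, - y0), and the latter
   may vanish. Take one denominator for each of the two points: if each vanishes at the other point,
   their sum vanishes at neither. *)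
have I_nz x0 : exists2 n, I n & n.[x0] != 0.
  have [y0 C] := closed_sqrt (wcub a b).[x0].
  have C' : (- y0) ^+ 2 = (wcub a b).[x0] by rewrite sqrrN.
  have [p [q [p' [q' [nz r]]]]] := gloc _ _ C.
  have [u [v [u' [v' [nz' r']]]]] := gloc _ _ C'.
  rewrite mulNr in nz'.
  have pqD : Dn p q by exists p', q'.
  have uvD : Dn u v by exists u', v'.
  have [z|nzpq] := eqVneq (p.[x0] - y0 * q.[x0]) 0; last first.
    exists (norm_poly a b p q); first exact: Dn_I.
    by rewrite (norm_poly_eval _ _ C) mulf_neq0.
  have [z'|nzuv] := eqVneq (u.[x0] + y0 * v.[x0]) 0; last first.
    exists (norm_poly a b u v); first exact: Dn_I.
    by rewrite (norm_poly_eval _ _ C) mulf_neq0.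
  exists (norm_poly a b (p + u) (q + v)); first exact/Dn_I/DnD.
  rewrite (norm_poly_eval _ _ C) !hornerD mulf_neq0 //.
    by rewrite mulrDr addrACA z' addr0.
  by rewrite mulrDr opprD addrACA z add0r.
(* If n has a root x0, the gcd of n with an element of the ideal not vanishing at x0 is again in the
   ideal and has smaller degree. *)
have I_one s : forall n : {poly K}, (size n <= s)%N -> n != 0 -> I n -> I 1.
  elim: s => [n|s IH n]; first by rewrite leqn0 size_poly_eq0 => /eqP-> /eqP.
  move=> ns nzn In; have [s1|/closed_rootP[x0 rx0]] := eqVneq (size n) 1%N.
    have [c nzc nE] := size_poly1P _ (introT eqP s1).
    have -> : 1 = c^-1%:P * n + 0 * n.
      by rewrite mul0r addr0 nE -polyCM mulVf.
    exact: I_lin.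
  have [n' In' nz'] := I_nz x0.
  have [[u v] /= uvE] := Bezoutp n n'.
  set r := u * n + v * n' in uvE.
  have Ir : I r by apply: I_lin.
  have rn' : r %| n' by rewrite (eqp_dvdl _ uvE) dvdp_gcdr.
  have rn : r %| n by rewrite (eqp_dvdl _ uvE) dvdp_gcdl.
  have rx : ~~ root r x0.
    by apply: contra nz' => /(root_dvdp rn').
  have nzr : r != 0 by apply: contraNneq rx => ->; rewrite root0.
  apply: (IH r) => //; rewrite -ltnS; apply: leq_trans ns.
  rewrite ltn_neqAle dvdp_leq // andbT (dvdp_size_eqp rn).
  by apply: contra rx => /eqp_root ->.
have [n In nz] := I_nz 0.
have nzn : n != 0 by apply: contraNneq nz => ->; rewrite horner0.
have [p [q r]] := I_one _ n (leqnn _) nzn In.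
by exists p, q; apply: rep_eq r => x y C; rewrite hornerC mul1r.
Qed.

End RegularFunctions.

(** * Morphisms of pointed curves *)

Section LocalExpression.
Variables (F : fieldType) (K : closedFieldType) (iota : {rmorphism F -> K}).
Local Notation "p ^i" := (map_poly iota p) (at level 2, format "p ^i").

Lemma map_wcub a b : (wcub a b)^i = wcub (iota a) (iota b).
Proof.
rewrite /wcub -!lock rmorphD rmorphD /= map_polyXn map_polyZ /=.
by rewrite map_polyX map_polyC.
Qed.

Section Source.
Variables a1 b1 : F.
Local Notation C x y := (y ^+ 2 = (wcub (iota a1) (iota b1)).[x]).

(* Functions on the affine curve given by polynomials over the small field. *)
Definition frep (p q : {poly F}) g := rep (iota a1) (iota b1) p^i q^i g.

Lemma frep_cst c : frep c%:P 0 (fun _ _ => iota c).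
Proof. by move=> x y _; rewrite map_polyC rmorph0 hornerC horner0 mulr0 addr0.
  Qed.

Lemma frepX : frep 'X 0 (fun x _ => x).
Proof. by move=> x y _; rewrite map_polyX rmorph0 hornerX horner0 mulr0 addr0.
  Qed.

Lemma frepY : frep 0 1 (fun _ y => y).
Proof. by move=> x y _; rewrite rmorph0 rmorph1 horner0 hornerC mulr1 add0r.
  Qed.

Lemma frepD p q p' q' g g' : frep p q g -> frep p' q' g' ->
  frep (p + p') (q + q') (fun x y => g x y + g' x y).
Proof. by move=> r r'; rewrite /frep !rmorphD; apply: repD. Qed.

Lemma frepM p q p' q' g g' : frep p q g -> frep p' q' g' ->
  exists u v, frep u v (fun x y => g x y * g' x y).
Proof.
move=> r r'; exists (p * p' + q * q' * wcub a1 b1), (p * q' + q * p').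
by rewrite /frep !rmorphD !rmorphM /= map_wcub; apply: repM.
Qed.

Definition freg g := exists p q, frep p q g.

Lemma fregM g g' : freg g -> freg g' -> freg (fun x y => g x y * g' x y).
Proof. by move=> [p [q r]] [p' [q' r']]; apply: frepM r r'. Qed.

Lemma fregD g g' : freg g -> freg g' -> freg (fun x y => g x y + g' x y).
Proof. by move=> [p [q r]] [p' [q' r']]; do 2!eexists; apply: frepD r r'. Qed.

Lemma freg_cst c : freg (fun _ _ => iota c).
Proof. by do 2!eexists; apply: frep_cst. Qed.

Lemma fregXn g n : freg g -> freg (fun x y => g x y ^+ n).
Proof.
move=> rg; elim: n => [|n IH].
  by have [p [q r]] := freg_cst 1; exists p, q => x y Cxy;
    rewrite -r // rmorph1.
have [p [q r]] := fregM rg IH; exists p, q => x y Cxy.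
by rewrite exprS r.
Qed.

Lemma dehomogenize (h : {mpoly F[3]}) :
  freg (fun x y => (map_mpoly iota h).@[row3 x y 1 0]).
Proof.
suff [p [q r]] : freg (fun x y => \sum_(m <- msupp h) iota h@_m *
   (x ^+ m 0 * y ^+ m 1)).
  exists p, q => x y Cxy; rewrite -r // map_mpoly_eval; apply: eq_bigr => m _.
  have -> : \prod_i row3 x y 1 0 i ^+ m i = x ^+ m 0 * y ^+ m 1 * 1 ^+ m 2%:R.
    by rewrite !big_ord_recr big_ord0 /= mul1r !mxE /=; do ![congr (_ * _)];
       congr (_ ^+ m _); apply: val_inj.
  by rewrite expr1n mulr1.
elim: (msupp h) => [|m s [p [q r]]].
  have [p [q r]] := freg_cst 0; exists p, q => x y Cxy.
  by rewrite big_nil -r // rmorph0.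
have fx : freg (fun x _ => x) by do 2!eexists; apply: frepX.
have fy : freg (fun _ y => y) by do 2!eexists; apply: frepY.
have [p' [q' r']] := fregD (fregM (freg_cst h@_m)
  (fregM (fregXn (m 0) fx) (fregXn (m 1) fy))) (ex_intro _ p (ex_intro _ q r)).
by exists p', q' => x y Cxy; rewrite big_cons r'.
Qed.

Lemma scale_descent (al : K) (d n : {poly F}) : d != 0 -> al *: d^i = n^i ->
  exists c, al = iota c.
Proof.
move=> nzd /(congr1 (fun p : {poly K} => p`_(size d).-1)).
rewrite coefZ !coef_map /= -lead_coefE => e.
exists (n`_(size d).-1 / lead_coef d).
by rewrite fmorph_div -e mulfK // fmorph_eq0 lead_coef_eq0.
Qed.

End Source.

Section Morphism.
Variables a1 b1 a2 b2 : F.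
Variable phi : P2 K -> P2 K.
Hypothesis phi_morph : is_morphism iota (wpoly a1 b1) (wpoly a2 b2) phi.
Hypothesis phi_aff : forall Q, Q \in gcurve iota (wpoly a1 b1) ->
  Q != Opt K -> phi Q != Opt K.
Local Notation C x y := (y ^+ 2 = (wcub (iota a1) (iota b1)).[x]).
Local Notation X := (fun x y => xc (phi (affpt x y))).
Local Notation Y := (fun x y => yc (phi (affpt x y))).

Lemma gcurve_affpt a b x y : (affpt x y \in gcurve iota (wpoly a b)) =
  (y ^+ 2 == (wcub (iota a) (iota b)).[x]).
Proof. by rewrite /gcurve map_wpoly affpt_curve wcub_eval. Qed.

Lemma morph_affpt x y : C x y ->
  phi (affpt x y) = affpt (X x y) (Y x y) /\
  Y x y ^+ 2 = (wcub (iota a2) (iota b2)).[X x y].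
Proof.
move=> /eqP; rewrite -gcurve_affpt => Cxy.
have := phi_morph.1 _ Cxy; rewrite {1}/gcurve map_wpoly => phiC.
by have [] := curve_affpt phiC (phi_aff Cxy (affpt_neqO _ _));
  rewrite wcub_eval.
Qed.

Lemma local_expression x0 y0 : C x0 y0 -> exists d e : {poly F},
  [/\ d^i.[x0] + y0 * e^i.[x0] != 0,
      freg a1 b1 (fun x y => (d^i.[x] + y * e^i.[x]) * X x y)
    & freg a1 b1 (fun x y => (d^i.[x] + y * e^i.[x]) * Y x y)].
Proof.
move=> C0; have /eqP := C0; rewrite -gcurve_affpt => Q0.
have [n [h [h_homog h_nz phiE]]] := phi_morph.2 _ Q0.
pose H i x y := (map_mpoly iota (h i)).@[row3 x y 1 0].
have hevalE x y : exists2 c, c != 0 & forall i,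
  heval iota h (affpt x y) 0 i = c * H i x y.
  have [c nzc cE] := affpt_hc x y; exists (c ^+ n); first by rewrite expf_neq0.
  move=> i; rewrite mxE cE -(dhomog_eval iota _ _ (h_homog i)).
  by apply: meval_eq => j; rewrite mxE.
have hcE x y : C x y -> heval iota h (affpt x y) != 0 ->
    exists2 c, c != 0 & forall i, hc (phi (affpt x y)) 0 i = c * H i x y.
  move=> /eqP; rewrite -gcurve_affpt => Cxy nz.
  have /vlineP[c cE] : hc (phi (affpt x y)) \in <[heval iota h (affpt x y)]>%VS.
    by rewrite -phiE // memv_pick.
  have nzc : c != 0.
    by apply: contraNneq (hc_neq0 (phi (affpt x y))) => c0;
      rewrite cE c0 scale0r.
  have [c' nzc' c'E] := hevalE x y; exists (c * c'); first exact: mulf_neq0.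
  by move=> i; rewrite cE mxE c'E mulrA.
have Hz x y : C x y -> heval iota h (affpt x y) != 0 -> H 2%:R x y != 0.
  move=> Cxy nz; have [c nzc cE] := hcE _ _ Cxy nz.
  have := affpt_z (X x y) (Y x y); rewrite -(morph_affpt Cxy).1 cE mulf_eq0.
  by rewrite negb_or => /andP[].
(* Where the local expression vanishes, both sides are 0; thus the identities hold on the whole
   affine curve, as [rep] demands. *)
have HX x y : C x y -> H 2%:R x y * X x y = H 0 x y /\ H 2%:R x y * Y x y =
  H 1 x y.
  move=> Cxy; have [z|nz] := eqVneq (heval iota h (affpt x y)) 0.
    have [c nzc cE] := hevalE x y.
    have H0 i : H i x y = 0.
      by have /eqP := cE i; rewrite z mxE eq_sym mulf_eq0 (negPf nzc) => /eqP.
    by rewrite !H0 !mul0r.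
  have [c nzc cE] := hcE _ _ Cxy nz; have nzH := Hz _ _ Cxy nz.
  have cK (k z : K) : k != 0 -> k * (c * z / (c * k)) = z.
    by move=> nzk; rewrite invfM mulrACA divff // mul1r mulrC divfK.
  by rewrite /xc /yc !cE !cK.
have [d [e de]] := dehomogenize a1 b1 (h 2%:R).
exists d, e; split.
- by rewrite -de //; apply: Hz.
- have [p [q r]] := dehomogenize a1 b1 (h 0); exists p, q => x y Cxy.
  by rewrite -de // -r //; have [] := HX _ _ Cxy.
- have [p [q r]] := dehomogenize a1 b1 (h 1); exists p, q => x y Cxy.
  by rewrite -de // -r //; have [] := HX _ _ Cxy.
Qed.

Lemma morph_regular :
  (exists p q, rep (iota a1) (iota b1) p q X) /\
  (exists p q, rep (iota a1) (iota b1) p q Y).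
Proof.
split; apply: regular_is_polynomial => x0 y0 C0;
  have [d [e [nz [p [q r]] [p' [q' r']]]]] := local_expression C0.
- by exists d^i, e^i, p^i, q^i.
- by exists d^i, e^i, p'^i, q'^i.
Qed.

(** A priori al and ga lie in K only. The local expressions have coefficients in F, so comparing
    components shows that al times a nonzero polynomial over F is again over F, and likewise for
    ga. *)
Lemma morph_descent al ga :
  (forall x y, C x y -> X x y = al * x /\ Y x y = ga * y) ->
  (exists c, al = iota c) /\ (exists c, ga = iota c).
Proof.
move=> XYE; have [y0 C0] := closed_sqrt (wcub (iota a1) (iota b1)).[0].
have [d [e [nz [p [q r]] [p' [q' r']]]]] := local_expression C0.
have nzi (f : {poly F}) : f^i != 0 -> f != 0.
  by apply: contraNneq => ->; rewrite rmorph0.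
have rX : rep (iota a1) (iota b1) (al *: (d * 'X)^i) (al *: (e * 'X)^i)
   (fun x y => (d^i.[x] + y * e^i.[x]) * X x y).
  move=> x y Cxy; rewrite (XYE _ _ Cxy).1 !hornerZ !rmorphM /= map_polyX
    !hornerM hornerX.
  ring.
have [eX1 eX2] := rep_uniq rX r.
have rY : rep (iota a1) (iota b1) (ga *: (e * wcub a1 b1)^i) (ga *: d^i)
   (fun x y => (d^i.[x] + y * e^i.[x]) * Y x y).
  move=> x y Cxy; rewrite (XYE _ _ Cxy).2 !hornerZ !rmorphM /= map_wcub
    !hornerM -Cxy.
  ring.
have [eY1 eY2] := rep_uniq rY r'.
have nzX : 'X != 0 :> {poly F} by rewrite polyX_eq0.
have [d0|nzd] := eqVneq d 0; last first.
  split; last exact: scale_descent nzd eY2.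
  by apply: scale_descent eX1; rewrite mulf_neq0.
have nze : e != 0.
  by apply: contraNneq nz => e0; rewrite d0 e0 rmorph0 !horner0 mulr0 addr0.
split.
  by apply: scale_descent eX2; rewrite mulf_neq0.
apply: scale_descent eY1; rewrite mulf_neq0 //.
by apply: nzi; rewrite map_wcub wcub_neq0.
Qed.

End Morphism.

End LocalExpression.

(** * Isomorphisms of Weierstrass curves as scalings *)

Section EllipticIsomorphism.
Variables (F : fieldType) (K : closedFieldType) (iota : {rmorphism F -> K}).

Lemma ell_isomorphism_scaling a1 b1 a2 b2 phi :
  2%:R != 0 :> F -> 3%:R != 0 :> F ->
  is_ell_isomorphism iota (wpoly a1 b1) (wpoly a2 b2) phi ->
  exists2 u : F, u != 0 & [/\ a2 = u ^+ 4 * a1, b2 = u ^+ 6 * b1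
    & forall x y, y ^+ 2 = x ^+ 3 + a1 * x + b1 ->
      phi (affpt (iota x) (iota y)) =
      affpt (iota (u ^+ 2 * x)) (iota (u ^+ 3 * y))].
Proof.
move=> nz2 nz3 [[phiM [psi [psiM phiK psiK]]] phiO].
have OC a b : Opt K \in gcurve iota (wpoly a b).
  by rewrite /gcurve map_wpoly Opt_curve.
have psiO : psi (Opt K) = Opt K by rewrite -{1}phiO phiK.
have phiA Q : Q \in gcurve iota (wpoly a1 b1) -> Q != Opt K -> phi Q != Opt K.
  by move=> CQ; apply: contraNneq => e; rewrite -(phiK Q) // e psiO.
have psiA Q : Q \in gcurve iota (wpoly a2 b2) -> Q != Opt K -> psi Q != Opt K.
  by move=> CQ; apply: contraNneq => e; rewrite -(psiK Q) // e phiO.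
have nzK n : n%:R != 0 :> F -> n%:R != 0 :> K by rewrite -(fmorph_eq0 iota)
  rmorph_nat.
have [[p1 [q1 rX]] [p2 [q2 rY]]] := morph_regular phiM phiA.
have [[r1 [s1 rX']] [r2 [s2 rY']]] := morph_regular psiM psiA.
have phiC := morph_affpt phiM phiA; have psiC := morph_affpt psiM psiA.
have C_in x y : y ^+ 2 = (wcub (iota a1) (iota b1)).[x] ->
    affpt x y \in gcurve iota (wpoly a1 b1).
  by rewrite gcurve_affpt => ->.
have psiphi x y : y ^+ 2 = (wcub (iota a1) (iota b1)).[x] ->
   psi (affpt (xc (phi (affpt x y))) (yc (phi (affpt x y)))) = affpt x y.
  by move=> Cxy; rewrite -(phiC _ _ Cxy).1 phiK // C_in.
have xE x y : y ^+ 2 = (wcub (iota a1) (iota b1)).[x] ->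
    x = r1.[xc (phi (affpt x y))] + yc (phi (affpt x y)) * s1.[xc (phi (affpt x
      y))].
  move=> Cxy; rewrite -(rX' _ _ (phiC _ _ Cxy).2) psiphi //.
  by rewrite xc_affpt.
have yE x y : y ^+ 2 = (wcub (iota a1) (iota b1)).[x] ->
    y = r2.[xc (phi (affpt x y))] + yc (phi (affpt x y)) * s2.[xc (phi (affpt x
      y))].
  move=> Cxy; rewrite -(rY' _ _ (phiC _ _ Cxy).2) psiphi //.
  by rewrite yc_affpt.
(* Since phi is onto, some point is sent to one with first coordinate e + 1. *)
have Xnc e : ~ (forall x y, y ^+ 2 = (wcub (iota a1) (iota b1)).[x] ->
    xc (phi (affpt x y)) = e).
  move=> Xe; have [y2 C2] := closed_sqrt (wcub (iota a2) (iota b2)).[e + 1].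
  have [psiE C1] := psiC _ _ C2.
  have := Xe _ _ C1; rewrite -psiE psiK; last by rewrite gcurve_affpt C2.
  rewrite xc_affpt => /eqP; rewrite -subr_eq0 addrAC subrr add0r.
  by rewrite oner_eq0.
have [al [ga [[nza nzg] lin e1 e2 e3]]] := curve_map_linear (nzK _ nz2) (nzK _
  nz3)
  rX rY (fun x y Cxy => (phiC x y Cxy).2) xE yE Xnc.
have [[al' alE] [ga' gaE]] := morph_descent phiM phiA lin.
rewrite alE gaE !fmorph_eq0 in nza nzg e1 e2 e3 lin.
have inj := fmorph_inj iota.
have {}e1 : ga' ^+ 2 = al' ^+ 3 by apply: inj; rewrite !rmorphXn.
have {}e2 : a2 * al' = ga' ^+ 2 * a1.
  by apply: inj; rewrite rmorphM e2 rmorphM rmorphXn.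
have {}e3 : b2 = ga' ^+ 2 * b1 by apply: inj; rewrite e3 rmorphM rmorphXn.
(* From ga^2 = al^3 this quotient satisfies u^2 = al and u^3 = ga. *)
pose u := ga' / al'.
have u2 : u ^+ 2 = al'.
  by rewrite /u expr_div_n e1 exprS mulfK // expf_neq0.
have u3 : u ^+ 3 = ga'.
  by rewrite exprS u2 divfK.
exists u; first by rewrite mulf_neq0 ?invr_neq0.
split.
- by apply: (mulIf nza); rewrite e2 e1 -u2; ring.
- by rewrite e3 e1 -u2; ring.
move=> x y Cxy.
have CK : iota y ^+ 2 = (wcub (iota a1) (iota b1)).[iota x].
  by rewrite wcub_eval -rmorphXn Cxy rmorphD rmorphD rmorphXn rmorphM.
by rewrite (phiC _ _ CK).1 (lin _ _ CK).1 (lin _ _ CK).2 u2 u3 !rmorphM.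
Qed.

Lemma scale_neq0 (c : K) (Q : P2 K) : c != 0 ->
  row3 (c ^+ 2 * hc Q 0 0) (c ^+ 3 * hc Q 0 1) (hc Q 0 2%:R) != 0.
Proof.
move=> nzc; apply: contraNneq (hc_neq0 Q) => /rowP e.
have := e 0; have := e 1; have := e 2%:R;
  rewrite !row3E ![(0 : 'rV_3) _ _]mxE => z0 /eqP.
rewrite mulf_eq0 (negPf (expf_neq0 _ nzc)) => /eqP y0 /eqP.
rewrite mulf_eq0 (negPf (expf_neq0 _ nzc)) => /eqP x0.
by apply/eqP/row3P; rewrite ?x0 ?y0 ?z0 mxE.
Qed.

Definition scale_pt (c : K) (nzc : c != 0) (Q : P2 K) : P2 K :=
  mkpt (scale_neq0 Q nzc).

Lemma scale_affpt c (nzc : c != 0) x y :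
  scale_pt nzc (affpt x y) = affpt (c ^+ 2 * x) (c ^+ 3 * y).
Proof.
have [d nzd dE] := affpt_hc x y.
have [k nzk kE] := hc_mkpt (scale_neq0 (affpt x y) nzc).
symmetry; apply: (P2_eq (v := row3 (c ^+ 2 * x) (c ^+ 3 * y) 1) (c := k * d))
  => //.
  exact: mulf_neq0.
rewrite kE dE; apply: row3P; rewrite !mxE /=; ring.
Qed.

Lemma scale_Opt c (nzc : c != 0) : scale_pt nzc (Opt K) = Opt K.
Proof.
have [d nzd dE] := hc_mkpt (row010_neq0 K).
have [k nzk kE] := hc_mkpt (scale_neq0 (Opt K) nzc).
symmetry; apply: (P2_eq (v := row3 0 1 0) (c := k * (c ^+ 3 * d))) => //.
  by rewrite !mulf_neq0 ?expf_neq0.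
rewrite kE dE; apply: row3P; rewrite !mxE /=; ring.
Qed.

Lemma scale_ptK c v (nzc : c != 0) (nzv : v != 0) a b : v * c = 1 ->
  {in curve (wpoly a b), cancel (scale_pt nzc) (scale_pt nzv)}.
Proof.
move=> vc Q CQ; have [->|QO] := eqVneq Q (Opt K); first by rewrite !scale_Opt.
have [-> _] := curve_affpt CQ QO; rewrite !scale_affpt.
by rewrite (mulrA (v ^+ 2)) (mulrA (v ^+ 3)) -!exprMn vc !expr1n !mul1r.
Qed.

Lemma scale_pt_morphism u a b (nzu : iota u != 0) :
  is_morphism iota (wpoly a b) (wpoly (u ^+ 4 * a) (u ^+ 6 * b)) (scale_pt nzu).
Proof.
split=> Q.
  rewrite /gcurve !map_wpoly => CQ.
  have [->|QO] := eqVneq Q (Opt K); first by rewrite scale_Opt Opt_curve.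
  have [QE C] := curve_affpt CQ QO; rewrite {1}QE scale_affpt affpt_curve.
  rewrite (rmorphM _ (u ^+ 4)) (rmorphM _ (u ^+ 6)) !rmorphXn.
  by rewrite exprMn C; apply/eqP; ring.
move=> CQ; pose h (i : 'I_3) : {mpoly F[3]} :=
  nth 0 [:: u ^+ 2 *: 'X_0; u ^+ 3 *: 'X_1; 'X_(2%:R)] i.
have hE R : heval iota h R =
    row3 (iota u ^+ 2 * hc R 0 0) (iota u ^+ 3 * hc R 0 1) (hc R 0 2%:R).
  apply: row3P; rewrite row3E mxE /h /= ?map_mpolyZ ?mevalZ map_mpolyX mevalXU
    //;
  by rewrite rmorphXn.
exists 1%N, h; split.
- move=> i; case: (ord3P i) => ->; rewrite /h /=.
  + by apply/dhomogZ; rewrite dhomogX /= mdeg1.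
  + by apply/dhomogZ; rewrite dhomogX /= mdeg1.
  + by rewrite dhomogX /= mdeg1.
- by rewrite hE scale_neq0.
by move=> R _ _; rewrite hE.
Qed.

Lemma scale_pt_isomorphism u a b (nzu : iota u != 0) :
  is_ell_isomorphism iota (wpoly a b) (wpoly (u ^+ 4 * a) (u ^+ 6 * b))
    (scale_pt nzu).
Proof.
have nzu' : u != 0 by rewrite -(fmorph_eq0 iota).
have nzv : iota u^-1 != 0 by rewrite fmorph_eq0 invr_eq0.
have vK n c : u^-1 ^+ n * (u ^+ n * c) = c.
  by rewrite exprVn mulKf ?expf_neq0.
split; last exact: scale_Opt.
split; first exact: scale_pt_morphism.
exists (scale_pt nzv); split.
- rewrite -{2}(vK 4%N a) -{2}(vK 6%N b); exact: scale_pt_morphism.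
- rewrite /gcurve map_wpoly => Q CQ.
  by apply: scale_ptK CQ; rewrite -rmorphM mulVf ?rmorph1.
- rewrite /gcurve map_wpoly => Q CQ.
  by apply: scale_ptK CQ; rewrite -rmorphM mulfV ?rmorph1.
Qed.

End EllipticIsomorphism.

(** * The groups attached to pointed curves *)

Section Points.
Variables (F : finFieldType) (E : weierstrass F) (P : P2 F).
Hypotheses (PE : P \in curve (weq E)) (PO : P != Opt F).

Lemma weierstrass_affpt : P = affpt (lambda P) (mu P).
Proof. by have [] := curve_affpt PE PO. Qed.

Lemma weierstrass_b :
  wb E = mu P ^+ 2 - lambda P ^+ 3 - wa E * lambda P.
Proof.
have [_ e] := curve_affpt PE PO; rewrite -[mu P]/(yc P) e -/(lambda P).
rewrite -[xc P]/(lambda P); ring.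
Qed.

(** [B_coef] and [Bc] agree only pointwise, and [baer] depends on the function itself; hence an
    isomorphism with identity components instead of an equality of groups. *)
Lemma G_EP_isog : 2%:R != 0 :> F ->
  [set: G_EP E P] \isog [set: baer (Bc (wa E) (lambda P) (mu P))].
Proof.
move=> nz2.
have H := @pair_baer_isog F 6 3 (B_coef E P) (Bc (wa E) (lambda P) (mu P)) id
  id nz2.
apply: H => //.
move=> u v; apply/colP => i; rewrite [LHS]mxE [RHS]mxE.
exact: (congr1 (fun M : 'M[F]_6 => (u^T *m M *m v) 0 0) (B_coef_Bc E P i)).
Qed.

End Points.

Lemma G_EP_isogP (F : finFieldType) (E E' : weierstrass F) (P P' : P2 F) :
  2%:R != 0 :> F ->
  [set: G_EP E P] \isog [set: G_EP E' P'] <->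
  [set: baer (Bc (wa E) (lambda P) (mu P))] \isog
  [set: baer (Bc (wa E') (lambda P') (mu P'))].
Proof.
move=> nz2; have iso := G_EP_isog E P nz2; have iso' := G_EP_isog E' P' nz2.
have osi := iso; have osi' := iso'; rewrite isog_sym in osi.
rewrite isog_sym in osi'.
split=> h; first exact: (isog_trans osi (isog_trans h iso')).
exact: (isog_trans iso (isog_trans h osi')).
Qed.

Lemma affpt_inj (k : fieldType) (x y x' y' : k) :
  affpt x y = affpt x' y' -> x = x' /\ y = y'.
Proof.
move=> e; have := congr1 (@yc k) e; have := congr1 (@xc k) e.
by rewrite !xc_affpt !yc_affpt.
Qed.

Theorem theorem1 (F : finFieldType) (p : nat) (charFp : p \in [pchar F])
    (p_ge5 : (5 <= p)%N)
    (K : closedFieldType) (iota : {rmorphism F -> K})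
    (K_alg : integralRange iota)
    (E E' : weierstrass F) (P P' : P2 F)
    (P_on_E : P \in curve (weq E)) (P_neqO : P != Opt F)
    (P'_on_E' : P' \in curve (weq E')) (P'_neqO : P' != Opt F) :
  ([set: G_EP E P] \isog [set: G_EP E' P'])%g
  <->
  exists2 sigma : gal_of {: pPrimeCharType charFp}, sigma \in GalFp charFp &
    exists2 phi : P2 K -> P2 K,
      is_ell_isomorphism iota
        (weq E') (map_mpoly (gal_map sigma) (weq E)) phi
    & phi (map_pt iota P') = map_pt iota (map_pt (gal_map sigma) P).
Proof.
have nz n : (0 < n < 5)%N -> n%:R != 0 :> F.
  move=> /andP[n0 n5]; rewrite -(dvdn_pcharf charFp) gtnNdvd //.
  exact: leq_trans p_ge5.
have nz2 : 2%:R != 0 :> F by apply: nz.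
have nz3 : 3%:R != 0 :> F by apply: nz.
have PE := weierstrass_affpt P_on_E P_neqO.
have PE' := weierstrass_affpt P'_on_E' P'_neqO.
have bE := weierstrass_b P_on_E P_neqO.
have bE' := weierstrass_b P'_on_E' P'_neqO.
have isoE := G_EP_isogP E E' P P' nz2.
rewrite weq_wpoly [weq E]weq_wpoly.
split=> [/isoE isoB | [s _ [phi]]].
  have [sigma [u nzu [aE lE mE]]] := isog_params nz2 nz3 isoB.
  have [s galS sE] := rmorphism_gal charFp sigma.
  exists s => //.
  have nzv : iota u^-1 != 0 by rewrite fmorph_eq0 invr_eq0.
  have vK n c : u^-1 ^+ n * (u ^+ n * c) = c.
    by rewrite exprVn mulKf ?expf_neq0.
  exists (scale_pt nzv); last first.
    rewrite PE PE' !map_affpt scale_affpt !sE lE mE.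
    by rewrite -!rmorphXn -!rmorphM !vK.
  (* As the points lie on the curves, b is m^2 - l^3 - a l, which is homogeneous of weight 6. *)
  have sbE : sigma (wb E) = u^-1 ^+ 6 * wb E'.
    apply: (mulfI (expf_neq0 6 nzu));
      rewrite mulrA -exprMn mulfV // expr1n mul1r.
    rewrite bE' bE aE lE mE !rmorphB !rmorphXn rmorphM; ring.
  have := scale_pt_isomorphism (wa E') (wb E') nzv.
  have saE : sigma (wa E) = u^-1 ^+ 4 * wa E' by rewrite aE vK.
  by rewrite -sbE -saE map_wpoly !sE.
rewrite map_wpoly => isoPhi.
have [u nzu [aE bE2 phiE]] := ell_isomorphism_scaling nz2 nz3 isoPhi.
have C' : mu P' ^+ 2 = lambda P' ^+ 3 + wa E' * lambda P' + wb E'.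
  by rewrite bE'; ring.
move=> e; rewrite PE PE' !map_affpt (phiE _ _ C') in e.
have [lE mE] := affpt_inj e.
have {}lE := fmorph_inj iota lE; have {}mE := fmorph_inj iota mE.
have vK n c : u^-1 ^+ n * (u ^+ n * c) = c.
  by rewrite exprVn mulKf ?expf_neq0.
apply/isoE; apply: (@params_isog F (gal_map s) u^-1); rewrite ?invr_neq0 //.
- by rewrite aE vK.
- by rewrite -lE vK.
- by rewrite -mE vK.
Qed.
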